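(* Let $\Sigma_1$ and $\Sigma_2$ be two complete smooth fans in $N_{\mathbb{R}}$ (with respect to the lattice $N = \mathbb{Z}^n/\mathbb{Z}e_{[n]}$), both refined by the braid arrangement fan $\mathcal{B}(n)$. Then there exists a third fan $\Sigma_3$ which can be obtained from $\Sigma_1$ by a finite sequence of smooth star subdivisions and which can also be obtained from $\Sigma_2$ by a finite sequence of smooth star subdivisions. Moreover, $\Sigma_3$ can always be taken to be $\mathcal{B}(n)$.
   Context: Notation. Let $[n] = \{1,\dots,n\}$, let $e_1,\dots,e_n$ be the standard basis of $\mathbb{Z}^n$, and for $A \subseteq [n]$ let $e_A = \sum_{i\in A} e_i$. Let $N = \mathbb{Z}^n/\mathbb{Z}e_{[n]}$ and $N_{\mathbb{R}} = \mathbb{R}\otimes_{\mathbb{Z}} N = \mathbb{R}^n/\mathbb{R}e_{[n]}$. For $1\le i<j\le n$ let $H_{ij}\subseteq N_{\mathbb{R}}$ be the hyperplane $x_i = x_j$ (well defined on the quotient). The braid arrangement is $\{H_{ij}\}_{1\le i<j\le n}$, and the braid arrangement fan $\mathcal{B}(n)$ is the complete fan in $N_{\mathbb{R}}$ it determines: its maximal cones are the closures of the connected components of the complement of the arrangement, i.e. the cones $\{x_{w(1)}\le x_{w(2)}\le\cdots\le x_{w(n)}\}$ for permutations $w$ of $[n]$ (the type $A_{n-1}$ Weyl chambers), and its cones are all faces of these. Fans. A fan is a finite collection of strongly convex rational polyhedral cones in $N_{\mathbb{R}}$, closed under taking faces, such that any two cones meet in a common face; it is complete if the union of its cones is $N_{\mathbb{R}}$.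 A complete fan $\Sigma$ is refined by $\mathcal{B}(n)$ if every cone of $\mathcal{B}(n)$ is contained in some cone of $\Sigma$ (equivalently, every cone of $\Sigma$ is a union of cones of $\mathcal{B}(n)$). For a cone $\sigma$, let $\sigma(1)$ be the set of minimal (primitive) lattice points of $N$ on the rays of $\sigma$. For a finite set $A\subseteq N$, $\mathrm{cone}(A) = \{\sum_{v\in A}\lambda_v v : \lambda_v\in\mathbb{R},\ \lambda_v\ge 0\}$. A cone $\sigma$ is smooth if $\sigma(1)$ can be extended to a $\mathbb{Z}$-basis of $N$; a fan is smooth if all its cones are. Star subdivision. Let $\Sigma$ be a smooth fan, $\tau\in\Sigma$ a nonzero cone, $\tau(1) = \{v_1,\dots,v_k\}$, and $v_0 = v_1+\cdots+v_k$. For $\sigma\in\Sigma$ with $\tau\subseteq\sigma$ put $$\Sigma^*_\sigma(\tau) = \{\mathrm{cone}(A) : A\subseteq\sigma(1)\cup\{v_0\},\ \tau(1)\not\subseteq A\}.$$ The (smooth) star subdivision of $\Sigma$ relative to $\tau$ is $$\Sigma^*(\tau) = \{\sigma\in\Sigma : \tau\not\subseteq\sigma\}\cup\bigcup_{\sigma\in\Sigma,\ \tau\subseteq\sigma}\Sigma^*_\sigma(\tau).$$ A fan $\Sigma'$ is obtained from $\Sigma$ by a sequence of smooth star subdivisions if there are fans $\Sigma = \Delta_0, \Delta_1, \dots, \Delta_\ell = \Sigma'$ ($\ell\ge 0$) with each $\Delta_i$ equal to a star subdivision of $\Delta_{i-1}$ relative to some nonzero cone of $\Delta_{i-1}$.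 *)

(* Defs.v *)
From HB Require Import structures.
From mathcomp Require Import all_boot all_order all_algebra perm.
From mathcomp Require Import generic_quotient ring_quotient.
From mathcomp Require Import boolp classical_sets cardinality fsbigop reals.

Set Implicit Arguments.
Unset Strict Implicit.
Unset Printing Implicit Defensive.

Import Order.TTheory GRing.Theory Num.Theory.
Import Quotient.

Local Open Scope classical_set_scope.
Local Open Scope quotient_scope.
Local Open Scope ring_scope.

Section QuotientModule.
Variables (K : comNzRingType) (n : nat).

Definition ones_line : {pred 'rV[K]_n} :=
  fun x => `[< exists a : K, x = a *: const_mx 1 >].

Lemma ones_lineP (x : 'rV[K]_n) :
  reflect (exists a : K, x = a *: const_mx 1) (x \in ones_line).
Proof. exact: asboolP. Qed.

Fact ones_line_zmod_closed : zmod_closed ones_line.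
Proof.
split; first by apply/ones_lineP; exists 0; rewrite scale0r.
move=> x y /ones_lineP[a ->] /ones_lineP[b ->].
by apply/ones_lineP; exists (a - b); rewrite scalerBl.
Qed.

HB.instance Definition _ :=
  GRing.isZmodClosed.Build 'rV[K]_n ones_line ones_line_zmod_closed.

Lemma ones_lineZ (a : K) (x : 'rV[K]_n) :
  x \in ones_line -> a *: x \in ones_line.
Proof.
by move=> /ones_lineP[b ->]; apply/ones_lineP; exists (a * b); rewrite scalerA.
Qed.

(* K^n / K e_[n], the image of x being proj x *)
Definition quo := {quot ones_line}.
HB.instance Definition _ := GRing.Zmodule.on quo.

Definition proj (x : 'rV[K]_n) : quo := \pi_({quot ones_line}) x.

Lemma proj_eq (x y : 'rV[K]_n) : (proj x == proj y) = (x - y \in ones_line).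
Proof. by rewrite [RHS]idealrBE. Qed.

Lemma projK (q : quo) : proj (repr q) = q.
Proof. exact: reprK. Qed.

Lemma projD (x y : 'rV[K]_n) : proj (x + y) = proj x + proj y.
Proof. exact: pi_addr. Qed.

Definition quo_scale (a : K) (q : quo) : quo := proj (a *: repr q).

Lemma quo_scale_proj (a : K) (x : 'rV[K]_n) :
  quo_scale a (proj x) = proj (a *: x).
Proof.
apply/eqP; rewrite proj_eq -scalerBr ones_lineZ //.
by rewrite -proj_eq projK.
Qed.

Fact quo_scalerA a b q :
  quo_scale a (quo_scale b q) = quo_scale (a * b) q.
Proof. by rewrite -[q]projK !quo_scale_proj scalerA. Qed.

Fact quo_scale1r : left_id 1 quo_scale.
Proof. by move=> q; rewrite -[q]projK quo_scale_proj scale1r. Qed.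

Fact quo_scalerDr : right_distributive quo_scale +%R.
Proof.
move=> a p q; rewrite -[p]projK -[q]projK -projD.
by rewrite !quo_scale_proj scalerDr projD.
Qed.

Fact quo_scalerDl q : {morph quo_scale^~ q : a b / a + b}.
Proof.
by move=> a b; rewrite -[q]projK !quo_scale_proj scalerDl projD.
Qed.

HB.instance Definition _ := GRing.Zmodule_isLmodule.Build K quo
  quo_scalerA quo_scale1r quo_scalerDr quo_scalerDl.

Lemma projZ (a : K) (x : 'rV[K]_n) : proj (a *: x) = a *: proj x.
Proof. by rewrite -quo_scale_proj. Qed.

End QuotientModule.

Local Notation N n := (quo int n).
Local Notation NR R n := (quo R n) (only parsing).

(* The map N -> N_R induced by the inclusion Z^n -> R^n *)
Definition latt (R : realType) (n : nat) (v : N n) : NR R n :=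
  proj (map_mx intr (repr v)).

Lemma latt_proj (R : realType) (n : nat) (x : 'rV[int]_n) :
  latt R (proj x) = proj (map_mx intr x).
Proof.
apply/eqP; rewrite proj_eq -map_mxB.
have /ones_lineP[a ->] : repr (proj x) - x \in @ones_line int n.
  by rewrite -proj_eq projK.
apply/ones_lineP; exists a%:~R.
by rewrite map_mxZ map_const_mx rmorph1.
Qed.

Section Fans.
Variables (R : realType) (n : nat).

(* For infinite A the sum is only over finitely supported families. *)
Definition cone (A : set (N n)) : set (NR R n) :=
  [set x | exists2 l : N n -> R,
     (forall v, 0 <= l v) & x = \sum_(v \in A) l v *: latt R v].

Definition rational_polyhedral (C : set (NR R n)) : Prop :=
  exists2 A : set (N n), finite_set A & C = cone A.

Definition strongly_convex (C : set (NR R n)) : Prop :=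
  forall x, C x -> C (- x) -> x = 0.

Definition face (C F : set (NR R n)) : Prop :=
  exists2 u : {scalar NR R n},
    (forall x, C x -> 0 <= u x) & F = [set x | C x /\ u x = 0].

Definition ray (C rho : set (NR R n)) : Prop :=
  face C rho /\
  exists2 x : NR R n, x != 0 & rho = [set t *: x | t in [set t : R | 0 <= t]].

Definition primitive (v : N n) : Prop :=
  v != 0 /\ forall (w : N n) (k : nat), v = w *+ k -> k = 1%N.

(* The paper's sigma(1) *)
Definition ray_gens (C : set (NR R n)) : set (N n) :=
  [set v | primitive v /\ exists2 rho, ray C rho & rho (latt R v)].

Definition Zbasis (b : seq (N n)) : Prop :=
  forall v : N n,
    exists! c : {ffun 'I_(size b) -> int}, v = \sum_(i < size b) b`_i *~ c i.

Definition smooth_cone (C : set (NR R n)) : Prop :=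
  exists2 b : seq (N n), Zbasis b & ray_gens C `<=` [set` b].

Definition is_fan (S : set (set (NR R n))) : Prop :=
  [/\ finite_set S,
      forall C, S C -> rational_polyhedral C /\ strongly_convex C,
      forall C F, S C -> face C F -> S F
    & forall C D, S C -> S D -> face C (C `&` D) /\ face D (C `&` D)].

Definition complete (S : set (set (NR R n))) : Prop :=
  \bigcup_(C in S) C = setT.

Definition smooth (S : set (set (NR R n))) : Prop :=
  forall C, S C -> smooth_cone C.

Definition refined_by (S B : set (set (NR R n))) : Prop :=
  forall D, B D -> exists2 C, S C & D `<=` C.

(* {x_w(1) <= ... <= x_w(n)}; the inequalities do not depend on the
   representative of the class *)
Definition chamber (w : 'S_n) : set (NR R n) :=
  [set proj x | x in [set x : 'rV[R]_n |
    forall i j : 'I_n, (i <= j)%N -> x ord0 (w i) <= x ord0 (w j)]].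

Definition braid_fan : set (set (NR R n)) :=
  [set F | exists w : 'S_n, face (chamber w) F].

Definition star_center (T : set (NR R n)) : N n :=
  \sum_(v \in ray_gens T) v.

Definition star_cones (T C : set (NR R n)) : set (set (NR R n)) :=
  [set cone A | A in [set A |
    A `<=` ray_gens C `|` [set star_center T] /\ ~ (ray_gens T `<=` A)]].

(* If T is a ray then star_center T is its own generator, and this literal
   definition deletes the cones containing T; such a step loses support, hence
   never occurs on the way to a complete fan. *)
Definition star_subdivision (S : set (set (NR R n))) (T : set (NR R n)) :
    set (set (NR R n)) :=
  [set C | S C /\ ~ (T `<=` C)] `|`
  \bigcup_(C in [set C | S C /\ T `<=` C]) star_cones T C.

Definition star_step (S S' : set (set (NR R n))) : Prop :=
  smooth S /\
  exists T, [/\ S T, T <> [set 0] & S' = star_subdivision S T].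

Definition obtained_by_stars (S S' : set (set (NR R n))) : Prop :=
  exists (l : nat) (D : nat -> set (set (NR R n))),
    [/\ D 0%N = S, D l = S',
        forall i, (i <= l)%N -> is_fan (D i)
      & forall i, (i < l)%N -> star_step (D i) (D i.+1)].

End Fans.

Arguments braid_fan : clear implicits.

(* Main.v *)
Require Import Defs.
From mathcomp Require Import all_boot all_order all_algebra perm.
From mathcomp Require Import generic_quotient.
From mathcomp Require Import boolp classical_sets cardinality fsbigop reals.
From mathcomp Require Import ring lra.
From HB Require Import structures.

Set Implicit Arguments.
Unset Strict Implicit.
Unset Printing Implicit Defensive.

Import Order.TTheory GRing.Theory Num.Theory.

Local Open Scope classical_set_scope.
Local Open Scope ring_scope.

(** Write e_T for the class of the indicator vector of a subset T of [n]. A cone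
    of a fan refined by the braid fan is generated by some of the e_T with T
    proper and nonempty, so a complete smooth fan of this kind is the same thing
    as a simplicial complex of families of subsets in which every vector has
    exactly one nonnegative representation [smooth_complex, fan_smooth_complex].

    If A and B belong to one family of the complex, then A and B are nested,
    disjoint, or have union [n]. Indeed e_A + e_B is also the sum of e_(A n B)
    and e_(A u B), whose sets form a chain and hence lie in a common cone of the
    fan; uniqueness of representations forbids this when A and B cross
    [complex_noncrossing]. When all families are chains the fan is the braid fan
    [chain_complex_braid]. Otherwise, complementing all the subsets if necessary
    (that is, replacing x by - x), some pair of disjoint sets A, B spans a cone;
    take such a pair with A u B of maximal cardinality and subdivide at
    cone(e_A, e_B). The new ray is e_(A u B), and every cone containing
    e_A and e_B is cut along the hyperplane on which the coordinates of e_A and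
    e_B are equal.

    The point is that this hyperplane belongs to the braid arrangement. By
    maximality, a member T of a family containing A and B is a subset of A or B,
    or of the complement of A u B, up to complementation. The members inside A
    cannot cover A, since the maximal ones would express e_A as a linear
    combination of other generators of the cone; the same holds for B and for
    the complement of A u B. Hence there are points a in A, b in B and m outside
    A u B that no other member separates [separating_points]. The coordinates of
    e_A and e_B are then x_a - x_m and x_b - x_m up to a common sign, and they
    are compared by the sign of x_a - x_b, which is constant on each chamber
    [star_chain, exists_star].

    Every such subdivision adds a ray, and the rays are indexed by subsets of
    [n], so the process stops, necessarily at the braid fan [complex_obtained]. *)

(** * Classes of indicator vectors *)
Section Differences.
Variables (K : comNzRingType) (n : nat).
Implicit Types (T A B : {set 'I_n}) (q : quo K n).

(** The class e_T. *)
Definition ev T : quo K n := proj (\row_i (i \in T)%:R).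

(** The functional x_i - x_j. These functionals separate the points of the
    quotient, so every identity between the vectors e_T reduces to a case
    analysis on membership. *)
Definition coord_diff (i j : 'I_n) q : K := repr q ord0 i - repr q ord0 j.

Lemma coord_diff_proj i j (x : 'rV[K]_n) :
  coord_diff i j (proj x) = x ord0 i - x ord0 j.
Proof.
have /ones_lineP[a E] : repr (proj x) - x \in @ones_line K n.
  by rewrite -proj_eq projK.
have Ek k : repr (proj x) ord0 k = a + x ord0 k.
  by have := congr1 (fun y : 'rV_n => y ord0 k) E; rewrite !mxE mulr1 => /eqP;
     rewrite subr_eq => /eqP.
by rewrite /coord_diff !Ek opprD addrACA subrr add0r.
Qed.

Lemma coord_diff_linear i j : linear_for *%R (coord_diff i j).
Proof.
move=> a p q; rewrite -[p]projK -[q]projK -projZ -projD !coord_diff_proj !mxE.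
by ring.
Qed.
HB.instance Definition _ i j :=
  GRing.isLinear.Build K (quo K n) K *%R (coord_diff i j) (coord_diff_linear i j).

Lemma coord_diff_ev i j T :
  coord_diff i j (ev T) = (i \in T)%:R - (j \in T)%:R.
Proof. by rewrite coord_diff_proj !mxE. Qed.

Lemma coord_diff_inj p q :
  (forall i j, coord_diff i j p = coord_diff i j q) -> p = q.
Proof.
rewrite -[p]projK -[q]projK; move: (repr p) (repr q) => x y E.
apply/eqP; rewrite proj_eq; apply/ones_lineP.
case: (pickP 'I_n) => [i0 _|n0].
  exists (x ord0 i0 - y ord0 i0); apply/rowP => i.
  have := E i i0; rewrite !coord_diff_proj !mxE mulr1 => Ei.
  by rewrite -[x ord0 i](subrK (x ord0 i0)) Ei; ring.
by exists 0; apply/rowP => i; have := n0 i.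
Qed.

Lemma ev_modular A B : ev A + ev B = ev (A :&: B) + ev (A :|: B).
Proof.
apply: coord_diff_inj => i j; rewrite !raddfD /= !coord_diff_ev !inE.
by do 4!case: (_ \in _); rewrite /=; ring.
Qed.

Lemma ev0 : ev finset.set0 = 0.
Proof.
by apply: coord_diff_inj => i j; rewrite raddf0 coord_diff_ev !inE subrr.
Qed.

Lemma evT : ev [set: 'I_n]%SET = 0.
Proof.
by apply: coord_diff_inj => i j; rewrite raddf0 coord_diff_ev !inE subrr.
Qed.

Lemma evC T : ev (~: T) = - ev T.
Proof.
apply: coord_diff_inj => i j; rewrite raddfN /= !coord_diff_ev !inE.
by do 2!case: (_ \in _); rewrite /=; ring.
Qed.

Lemma ev_sum T : ev T = \sum_(i in T) ev [set i].
Proof.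
apply: coord_diff_inj => j k; rewrite raddf_sum /= coord_diff_ev.
under eq_bigr => i _ do rewrite coord_diff_ev !inE.
have S (l : 'I_n) : \sum_(i in T) ((l == i)%:R : K) = (l \in T)%:R.
  have [lT|lT] := boolP (l \in T).
    rewrite (bigD1 l) //= eqxx big1 ?addr0 // => i /andP[_ /negPf].
    by rewrite eq_sym => ->.
  by rewrite big1 // => i iT; case: eqP => // li; rewrite li iT in lT.
by rewrite sumrB !S.
Qed.

Definition proper_set T := (T != finset.set0) && (T != [set: 'I_n]%SET).

Lemma proper_setP T :
  reflect (exists i j, i \in T /\ j \notin T) (proper_set T).
Proof.
apply: (iffP andP) => [[/set0Pn[i iT] nT]|[i [j [iT jT]]]].
  have /set0Pn[j] : ~: T != finset.set0.
    by apply: contraNneq nT => E; rewrite -(finset.setCK T) E finset.setC0.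
  by rewrite inE => jT; exists i, j.
split; first by apply/set0Pn; exists i.
by apply: contraNneq jT => ->; rewrite inE.
Qed.

Lemma proper_setC T : proper_set (~: T) = proper_set T.
Proof.
by apply/proper_setP/proper_setP => -[i [j [iT jT]]]; exists j, i;
   move: iT jT; rewrite !inE ?negbK.
Qed.

Lemma ev_neq0 T : proper_set T -> ev T != 0.
Proof.
move=> /proper_setP[i [j [iT jT]]]; apply/eqP => E.
have := congr1 (coord_diff i j) E.
by rewrite raddf0 coord_diff_ev iT (negPf jT) subr0 => /eqP; rewrite oner_eq0.
Qed.

End Differences.

Section Functionals.
Variables (R : realType) (n : nat).

Lemma evZ_inj (a b : R) (A B : {set 'I_n}) :
  proper_set A -> 0 < a -> 0 < b -> a *: ev R A = b *: ev R B -> A = B.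
Proof.
move=> /proper_setP[i [j [iA jA]]] a0 b0 E.
have P k l : k \in A -> l \notin A -> (k \in B) && (l \notin B).
  move=> kA lA; have := congr1 (coord_diff k l) E.
  rewrite !linearZ /= !coord_diff_ev kA (negPf lA).
  by case: (k \in B) (l \in B) => -[] //=; lra.
apply/setP => m; have [mA|mA] := boolP (m \in A).
  by have /andP[] := P m j mA jA.
by have /andP[_ /negPf] := P i m iA mA.
Qed.

Lemma ev_inj (A B : {set 'I_n}) :
  proper_set A -> ev R A = ev R B -> A = B.
Proof. by move=> pA E; apply: (@evZ_inj 1 1) => //; rewrite !scale1r. Qed.

Lemma latt_ev (T : {set 'I_n}) : latt R (ev int T) = ev R T.
Proof.
rewrite latt_proj; congr proj; apply/rowP => i; rewrite !mxE.
by case: (i \in T).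
Qed.

Lemma ev_int_inj (A B : {set 'I_n}) :
  proper_set A -> ev int A = ev int B -> A = B.
Proof. by move=> pA E; apply: ev_inj => //; rewrite -!latt_ev E. Qed.

(** The values on the classes e_{i} sum to u(e_[n]) = 0, so the linear form on
    R^n with these coefficients descends to the quotient. *)
Lemma extend_functional (u : {additive quo int n -> int}) :
  exists v : {scalar quo R n}, forall T, v (ev R T) = (u (ev int T))%:~R.
Proof.
pose w (x : 'rV[R]_n) : R := \sum_i (u (ev int [set i]))%:~R * x ord0 i.
have w_lin a x y : w (a *: x + y) = a * w x + w y.
  rewrite /w mulr_sumr -big_split /=; apply: eq_bigr => i _; rewrite !mxE; ring.
have w1 : w (const_mx 1) = 0.
  rewrite /w; under eq_bigr do rewrite mxE mulr1.
  have := congr1 u (ev_sum int [set: 'I_n]%SET).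
  rewrite evT raddf0 raddf_sum /= => /(congr1 (fun z : int => z%:~R : R)).
  rewrite /= rmorph_sum /= => E; rewrite [RHS]E; apply: eq_bigl => i.
  by rewrite inE.
have w_proj x : w (repr (proj x)) = w x.
  have /ones_lineP[a E] : repr (proj x) - x \in @ones_line R n.
    by rewrite -proj_eq projK.
  by rewrite -[repr _](subrK x) E w_lin w1 mulr0 add0r.
(* The representative does not matter, by w1. *)
pose f (q : quo R n) := w (repr q).
have f_lin : linear_for *%R f.
  move=> a p q; rewrite /f -w_lin -[in LHS](projK p) -[in LHS](projK q).
  by rewrite -projZ -projD w_proj.
exists (HB.pack_for {linear quo R n -> R | *%R} f
          (GRing.isLinear.Build R (quo R n) R *%R f f_lin)) => T /=.
rewrite /f w_proj /w ev_sum raddf_sum rmorph_sum /=.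
rewrite [RHS]big_mkcond; apply: eq_bigr => i _; rewrite mxE.
by case: (i \in T); rewrite ?mulr1 ?mulr0.
Qed.

End Functionals.

(** * Cones spanned by families of subsets *)
Section Pcone.
Variables (R : realType) (n : nat).
Local Notation V := (quo R n).
Local Notation I := 'I_n.
Implicit Types (T A B : {set I}) (s t : {set {set I}}) (C D F : set V).

(** The cone over the e_T with T in s, with real coefficients indexed by subsets
    rather than by lattice vectors. *)
Definition pcone s : set V :=
  [set x | exists2 c : {set I} -> R,
     (forall T, 0 <= c T) & x = \sum_(T in s) c T *: ev R T].

Definition convex_cone C :=
  [/\ C 0, forall x y, C x -> C y -> C (x + y)
    & forall a x, 0 <= a -> C x -> C (a *: x)].

Lemma convex_cone_sum C J (r : seq J) (P : pred J) (f : J -> V) :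
  convex_cone C -> (forall j, P j -> C (f j)) -> C (\sum_(j <- r | P j) f j).
Proof. by move=> [C0 CD _] Cf; apply: big_ind. Qed.

Lemma pcone_convex s : convex_cone (pcone s).
Proof.
split=> [|x y [c c0 ->] [d d0 ->]|a x a0 [c c0 ->]].
- by exists (fun=> 0) => //; rewrite big1 // => T _; rewrite scale0r.
- exists (fun T => c T + d T) => [T|]; first by rewrite addr_ge0.
  by rewrite -big_split; apply: eq_bigr => T _; rewrite scalerDl.
- exists (fun T => a * c T) => [T|]; first by rewrite mulr_ge0.
  by rewrite scaler_sumr; apply: eq_bigr => T _; rewrite scalerA.
Qed.

Lemma pcone_ev s T : T \in s -> pcone s (ev R T).
Proof.
move=> sT; exists (fun U => (U == T)%:R) => [U|]; first exact: ler0n.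
rewrite (bigD1 T) //= eqxx scale1r big1 ?addr0 // => U /andP[_ /negPf ->].
by rewrite scale0r.
Qed.

Lemma pcone_min s C :
  convex_cone C -> (forall T, T \in s -> C (ev R T)) -> pcone s `<=` C.
Proof.
move=> cC Cs x [c c0 ->]; apply: convex_cone_sum => // T /Cs CT.
by case: cC => _ _; apply.
Qed.

Lemma pcone_sub s t : s \subset t -> pcone s `<=` pcone t.
Proof.
move=> /fintype.subsetP st.
by apply: pcone_min (pcone_convex t) _ => T /st; apply: pcone_ev.
Qed.

Lemma cone_convex (A : set (quo int n)) :
  finite_set A -> convex_cone (@cone R n A).
Proof.
move=> fA; split=> [|x y [c c0 ->] [d d0 ->]|a x a0 [c c0 ->]].
- by exists (fun=> 0) => //; rewrite fsbig1 // => v _; rewrite scale0r.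
- exists (fun v => c v + d v) => [v|]; first by rewrite addr_ge0.
  by rewrite -fsbig_split //; apply: eq_fsbigr => v _; rewrite scalerDl.
- exists (fun v => a * c v) => [v|]; first by rewrite mulr_ge0.
  rewrite !fsbig_finite // scaler_sumr; apply: eq_bigr => v _.
  by rewrite scalerA.
Qed.

Definition proper_family s := {in s, forall T, proper_set T}.

Definition evs s : set (quo int n) := @ev int n @` [set` s].

Lemma evs_fin s : finite_set (evs s).
Proof. exact/finite_image/finite_finset. Qed.

Lemma evs_inj s t : proper_family s -> proper_family t ->
  evs s = evs t -> s = t.
Proof.
have sub s1 s2 : proper_family s1 -> evs s1 = evs s2 -> s1 \subset s2.
  move=> p1 E; apply/fintype.subsetP => T T1.
  have : evs s2 (ev int T) by rewrite -E; exists T.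
  by move=> [U U2 /esym/(ev_int_inj R (p1 T T1)) ->].
by move=> ps pt E; apply/eqP; rewrite finset.eqEsubset !sub.
Qed.

Lemma sum_evs (M : zmodType) s (f : quo int n -> M) : proper_family s ->
  \sum_(v \in evs s) f v = \sum_(T in s) f (ev int T).
Proof.
move=> ps; rewrite fsbig_image; last first.
  move=> S T; rewrite !inE => /ps pS _; exact: (ev_int_inj R pS).
rewrite (@bigfs _ _ _ _ (index_enum {set I}) (mem s)) ?index_enum_uniq //.
by move=> T _; rewrite mem_index_enum.
Qed.

Lemma cone_evs s : proper_family s -> @cone R n (evs s) = pcone s.
Proof.
move=> ps; rewrite eqEsubset; split=> x.
  move=> [c c0 ->]; rewrite sum_evs //; exists (fun T => c (ev int T)) => //.
  by apply: eq_bigr => T _; rewrite latt_ev.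
apply: pcone_min; first exact/cone_convex/evs_fin.
move=> T sT; exists (fun v => (v == ev int T)%:R) => [v|]; first exact: ler0n.
rewrite sum_evs // (bigD1 T) //= eqxx scale1r latt_ev big1 ?addr0 //.
move=> U /andP[sU /eqP UT]; case: eqP => [/(ev_int_inj R (ps U sU))//|_].
by rewrite scale0r.
Qed.

(** Linear independence, in the form in which it is used: each generator has a
    dual functional. *)
Definition indep s := forall A, A \in s ->
  exists u : {scalar V}, u (ev R A) = 1 /\
    forall T, T \in s -> T != A -> u (ev R T) = 0.

Lemma dual_coef s A (c : {set I} -> R) (u : {scalar V}) :
  A \in s -> u (ev R A) = 1 ->
  (forall T, T \in s -> T != A -> u (ev R T) = 0) ->
  u (\sum_(T in s) c T *: ev R T) = c A.
Proof.
move=> sA uA u0; rewrite raddf_sum (bigD1 A) //= linearZ /= uA mulr1.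
by rewrite big1 ?addr0 // => T /andP[sT TA]; rewrite linearZ /= u0 ?mulr0.
Qed.

Lemma indep_coef s (c d : {set I} -> R) : indep s ->
  \sum_(T in s) c T *: ev R T = \sum_(T in s) d T *: ev R T ->
  forall T, T \in s -> c T = d T.
Proof.
move=> is_ E A sA; have [u [uA u0]] := is_ A sA.
by rewrite -(dual_coef c sA uA u0) E (dual_coef d sA uA u0).
Qed.

Lemma indep_proper s : indep s -> proper_family s.
Proof.
move=> is_ A sA; have [u [uA _]] := is_ A sA.
apply/andP; split; apply/eqP => E; move: uA.
  by rewrite E ev0 raddf0 => /eqP; rewrite eq_sym oner_eq0.
by rewrite E evT raddf0 => /eqP; rewrite eq_sym oner_eq0.
Qed.

Definition unimodular s :=
  exists2 b : seq (quo int n), Zbasis b & forall T, T \in s -> ev int T \in b.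

Lemma unimodular_sub s t : s \subset t -> unimodular t -> unimodular s.
Proof. by move=> /fintype.subsetP st [b Zb tb]; exists b => // T /st/tb. Qed.

(** Uniqueness of coordinates makes each coordinate additive. *)
Lemma Zbasis_coord (b : seq (quo int n)) (i : 'I_(size b)) : Zbasis b ->
  exists u : {additive quo int n -> int},
    forall j : 'I_(size b), u b`_j = (i == j)%:R.
Proof.
move=> Zb; have [c cP] := boolp.choice Zb.
have uniq_c v (d : {ffun 'I_(size b) -> int}) :
    v = \sum_(k < size b) b`_k *~ d k -> c v = d.
  by case: (cP v) => _; apply.
pose f v := c v i.
have fB : zmod_morphism f.
  move=> v w; rewrite /f (uniq_c _ [ffun k => c v k - c w k]) ?ffunE //.
  rewrite {1}(cP v).1 {1}(cP w).1 -sumrB; apply: eq_bigr => k _.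
  by rewrite ffunE mulrzBr.
exists (HB.pack_for {additive quo int n -> int} f
  (GRing.isZmodMorphism.Build (quo int n) int f fB)) => j /=.
rewrite /f (uniq_c _ [ffun k => (k == j)%:R]) ?ffunE //.
rewrite (bigD1 j) //= ffunE eqxx big1 ?addr0 // => k /negPf kj.
by rewrite ffunE kj mulr0z.
Qed.

Lemma unimodular_indep s : proper_family s -> unimodular s -> indep s.
Proof.
move=> ps [b Zb sb] A sA.
have bi T : T \in s -> exists j : 'I_(size b), b`_j = ev int T.
  by move=> /sb Tb; exists (Ordinal (etrans (index_mem _ _) Tb)); exact: nth_index.
have [i Ei] := bi A sA; have [u uP] := Zbasis_coord i Zb.
have [v vP] := extend_functional R u; exists v; split.
  by rewrite vP -Ei uP eqxx.
move=> T sT TA; have [j Ej] := bi T sT; rewrite vP -Ej uP.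
case: eqP => // ij; case/eqP: TA; apply: (ev_int_inj R (ps T sT)).
by rewrite -Ej -Ei ij.
Qed.

End Pcone.

(** * Faces and rays of independent families *)
Section Faces.
Variables (R : realType) (n : nat).
Local Notation V := (quo R n).
Local Notation I := 'I_n.
Implicit Types (T A B : {set I}) (s t : {set {set I}}) (C D F : set V).
Local Notation pcone := (@pcone R n).
Local Notation indep := (@indep R n).

(** A functional that is nonnegative on the generators vanishes at a nonnegative
    combination only if it vanishes at each generator used. *)
Lemma pcone_face_sub s F : face (pcone s) F ->
  exists2 t : {set {set I}}, t \subset s & F = pcone t.
Proof.
move=> [u u0 ->].
have us T : T \in s -> 0 <= u (ev R T) by move=> /(pcone_ev R)/u0.
pose t := [set T in s | u (ev R T) == 0]%SET.
have ts : t \subset s by apply/fintype.subsetP => T; rewrite inE => /andP[].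
exists t => //; rewrite eqEsubset; split=> x; last first.
  move=> tx; split; first exact: pcone_sub ts x tx.
  case: tx => c _ ->; rewrite raddf_sum /= big1 // => T.
  by rewrite inE linearZ /= => /andP[_ /eqP ->]; rewrite mulr0.
move=> [[c c0 ->]]; rewrite raddf_sum /= => E; exists c => //.
have {}E : \sum_(T in s) c T * u (ev R T) == 0.
  by rewrite -[X in _ == X]E; apply/eqP; apply: eq_bigr => T _; rewrite linearZ.
move: E; rewrite psumr_eq0 => [/allP E|T sT]; last by rewrite mulr_ge0 ?us.
rewrite (bigID (mem t)) /= [X in _ + X]big1 ?addr0 => [|T /andP[sT]].
  apply: eq_bigl => T; case: (boolP (T \in t)); rewrite ?andbF // andbT.
  by move/(fintype.subsetP ts).
have := E T (mem_index_enum T); rewrite !inE sT mulf_eq0 /=.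
by move=> /orP[/eqP ->|->//]; rewrite scale0r.
Qed.

(** The supporting functional is the sum of the dual functionals of the
    generators outside t. *)
Lemma pcone_faceP s t : indep s -> t \subset s -> face (pcone s) (pcone t).
Proof.
move=> is_ ts.
have /boolp.choice[u uP] A : exists u : {scalar V}, A \in s ->
    u (ev R A) = 1 /\ forall T, T \in s -> T != A -> u (ev R T) = 0.
  have [/is_[u uA]|_] := boolP (A \in s); first by exists u.
  by exists \0.
pose w x := \sum_(A in s :\: t) u A x.
have w_lin : linear_for *%R w.
  move=> a x y; rewrite /w mulr_sumr -big_split; apply: eq_bigr => A _ /=.
  by rewrite linearP.
have wE T : T \in s -> w (ev R T) = (T \notin t)%:R.
  move=> sT; have [tT|tT] := boolP (T \in t).
    rewrite /w big1 // => A; rewrite inE => /andP[tA sA].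
    by rewrite (uP A sA).2 //; apply: contraNneq tA => <-.
  rewrite /w (bigD1 T) /= ?inE ?tT // (uP T sT).1 big1 ?addr0 // => A.
  rewrite inE => /andP[/andP[_ sA] AT]; apply: (uP A sA).2 => //.
  by rewrite eq_sym.
have [w' w'P] : exists w' : {scalar V}, w' =1 w.
  by exists (HB.pack_for {linear V -> R | *%R} w
               (GRing.isLinear.Build R V R *%R w w_lin)).
have w'E c : w' (\sum_(T in s) c T *: ev R T) =
             \sum_(T in s) c T * (T \notin t)%:R.
  rewrite raddf_sum /=; apply: eq_bigr => T sT.
  by rewrite linearZ /= w'P wE.
exists w' => [x [c c0 ->]|].
  by rewrite w'E; apply: sumr_ge0 => T _; rewrite mulr_ge0.
rewrite eqEsubset; split=> x.
  move=> tx; split; first exact: pcone_sub ts x tx.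
  case: tx => c _ ->; rewrite raddf_sum /= big1 // => T tT.
  rewrite linearZ /= w'P wE ?tT ?mulr0 //.
  exact: (fintype.subsetP ts).
move=> [[c c0 ->]]; rewrite w'E => /eqP.
rewrite psumr_eq0 => [/allP E|T sT]; last by rewrite mulr_ge0.
exists c => //.
rewrite (bigID (mem t)) /= [X in _ + X]big1 ?addr0 => [|T /andP[sT tT]].
  apply: eq_bigl => T; case: (boolP (T \in t)); rewrite ?andbF // andbT.
  by move/(fintype.subsetP ts).
have := E T (mem_index_enum T); rewrite sT tT mulr1 => /eqP ->.
by rewrite scale0r.
Qed.

Lemma pcone_coef_supp s t (c : {set I} -> R) : indep s -> t \subset s ->
  pcone t (\sum_(T in s) c T *: ev R T) ->
  forall T, T \in s -> T \notin t -> c T = 0.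
Proof.
move=> is_ /fintype.subsetP ts [d d0 E] A sA tA.
have [u [uA u0]] := is_ A sA.
rewrite -(dual_coef c sA uA u0) E raddf_sum /= big1 // => T tT.
rewrite linearZ /= u0 ?mulr0 //; first exact: ts.
by apply: contraNneq tA => <-.
Qed.

Lemma pcone_strongly_convex s : indep s -> strongly_convex (pcone s).
Proof.
move=> is_ x [c c0 Ex] [d d0 Ed].
have E T : T \in s -> c T + d T = 0.
  move: T; apply: (@indep_coef R n s (fun T => c T + d T) (fun=> 0)) => //.
  rewrite [RHS]big1 => [|T _]; last by rewrite scale0r.
  under eq_bigr do rewrite scalerDl.
  by rewrite big_split /= -Ex -Ed subrr.
rewrite Ex big1 // => T /E /eqP; rewrite paddr_eq0 // => /andP[/eqP -> _].
by rewrite scale0r.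
Qed.

Lemma pcone_rational s : proper_family s -> rational_polyhedral (pcone s).
Proof. by move=> ps; exists (evs s); [exact: evs_fin|rewrite cone_evs]. Qed.

Lemma pcone1 A :
  pcone [set A]%SET = [set a *: ev R A | a in [set a : R | 0 <= a]].
Proof.
rewrite eqEsubset; split=> x.
  by move=> [c c0 ->]; exists (c A); rewrite //= big_set1.
move=> [a a0 <-]; exists (fun=> a) => //.
by rewrite big_set1.
Qed.

Lemma pcone0 : pcone finset.set0 = [set 0].
Proof.
rewrite eqEsubset; split=> x; first by move=> [c c0 ->]; rewrite big_set0.
by move=> ->; have [] := @pcone_convex R n finset.set0.
Qed.

Lemma ev_primitive A : proper_set A -> primitive (ev int A).
Proof.
move=> pA; split; first by apply: ev_neq0.
move=> w k E; have /proper_setP[i [j [iA jA]]] := pA.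
have := congr1 (coord_diff i j) E.
rewrite coord_diff_ev iA (negPf jA) subr0 raddfMn /= -[_ *+ k]mulr_natr.
move=> /(congr1 absz); rewrite abszM [k%:R]natz => E1.
have /eqP : (`|coord_diff i j w| * k)%N = 1%N by rewrite -E1.
by rewrite muln_eq1 => /andP[_ /eqP].
Qed.

Lemma coord_diff_latt i j (v : quo int n) :
  coord_diff i j (latt R v) = (coord_diff i j v)%:~R.
Proof. by rewrite /latt coord_diff_proj !mxE -rmorphB. Qed.

(** The factor a is a difference of coordinates of v, hence an integer, and v is
    that multiple of e_A already in the lattice. *)
Lemma primitive_on_ray A (v : quo int n) (a : R) : proper_set A -> 0 <= a ->
  primitive v -> latt R v = a *: ev R A -> v = ev int A.
Proof.
move=> pA a0 [v0 vP] E; have /proper_setP[i [j [iA jA]]] := pA.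
have aE : a = (coord_diff i j v)%:~R.
  by rewrite -coord_diff_latt E linearZ /= coord_diff_ev iA (negPf jA) subr0 mulr1.
have vE : v = ev int A *~ coord_diff i j v.
  apply: coord_diff_inj => k l; apply: (@intr_inj R).
  rewrite -coord_diff_latt E linearZ /= aE raddfMz /= mulrzz intrM.
  by rewrite -latt_ev coord_diff_latt mulrC.
move: a0; rewrite aE ler0z; move: vE.
case: (coord_diff i j v) => // k vE _.
by rewrite vE (vP _ _ vE).
Qed.

(** A ray is the cone over a subfamily, and this subfamily contains some A since
    a ray is not 0; hence the ray is spanned by e_A. *)
Lemma ray_gens_pcone s : indep s -> ray_gens (pcone s) = evs s.
Proof.
move=> is_; have ps := indep_proper is_; rewrite eqEsubset; split=> v.
  move=> [pv [rho [/pcone_face_sub[t ts ->] [x x0 Ex]] tv]].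
  have [A tA] : exists A, A \in t.
    apply/set0Pn; apply: contraNneq x0 => t0.
    have : pcone t x by rewrite Ex; exists 1; rewrite /= ?ler01 ?scale1r.
    by rewrite t0 pcone0 => ->.
  have sA := fintype.subsetP ts A tA; exists A => //.
  have := @pcone_ev R n t A tA; rewrite Ex => -[a /= a0 aE].
  move: tv; rewrite Ex => -[b /= b0 bE].
  have an0 : a != 0.
    by apply: contraTneq (ev_neq0 R (ps A sA)) => a00; rewrite -aE a00 scale0r eqxx.
  apply/esym; apply: (@primitive_on_ray A v (b / a)) => //; first exact: ps.
    by rewrite divr_ge0.
  by rewrite -bE -aE scalerA divfK.
move=> [A /= sA <-]; split; first exact/ev_primitive/ps.
exists (pcone [set A]%SET); last by rewrite latt_ev; apply: pcone_ev; rewrite inE.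
split; first by apply: pcone_faceP; rewrite // finset.sub1set.
by exists (ev R A); [exact/ev_neq0/ps|rewrite pcone1].
Qed.

Lemma smooth_cone_pcone s : indep s -> smooth_cone (pcone s) <-> unimodular s.
Proof.
move=> is_; rewrite /smooth_cone ray_gens_pcone //; split=> -[b Zb sb].
  by exists b => // T sT; apply: sb; exists T.
by exists b => // _ [T sT <-]; exact: sb.
Qed.

Lemma pcone_inj s t : indep s -> indep t -> pcone s = pcone t -> s = t.
Proof.
move=> is_ it E; apply: (evs_inj R (indep_proper is_) (indep_proper it)).
by rewrite -!ray_gens_pcone // E.
Qed.

End Faces.

(** * Smooth complete fans as complexes of families of subsets *)
Section Complexes.
Variables (R : realType) (n : nat).
Local Notation V := (quo R n).
Local Notation I := 'I_n.
Implicit Types (T A B X : {set I}) (s t f : {set {set I}}).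
Implicit Types (D : {set {set {set I}}}) (c d : {set I} -> R).
Local Notation pcone := (@pcone R n).
Local Notation indep := (@indep R n).

Definition supp c := [set T | c T != 0]%SET.

(** The sum may range over all subsets because the coefficients vanish outside
    the support, which is a family of D. *)
Definition represents D c (x : V) :=
  [/\ forall T, 0 <= c T, supp c \in D & x = \sum_T c T *: ev R T].

(** Nested, disjoint or with union [n]: each of the four regions cut out by A
    and B is tested for being empty. *)
Definition noncrossing A B :=
  [|| A \subset B, B \subset A, A \subset ~: B | ~: A \subset B].

Definition is_chain f :=
  {in f &, forall S T : {set I}, (S \subset T) || (T \subset S)}.

(** The combinatorial form of a complete smooth fan refined by the braid fan:
    complex_ex is completeness, complex_uniq says that cones meet along common
    faces, and complex_chain is the refinement condition, the cones of the braid
    fan being those over chains of subsets. *)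
Record smooth_complex D : Prop := SmoothComplex {
  complex_sub : forall s t, s \in D -> t \subset s -> t \in D;
  complex_proper : forall s, s \in D -> proper_family s;
  complex_unimodular : forall s, s \in D -> unimodular s;
  complex_ex : forall x, exists c, represents D c x;
  complex_uniq : forall x c d, represents D c x -> represents D d x -> c =1 d;
  complex_chain : forall f, is_chain f ->
    exists2 s, s \in D & forall T, T \in f -> pcone s (ev R T) }.

Definition fan_of D : set (set V) := pcone @` [set` D].

Lemma sum_supp c s : supp c \subset s ->
  \sum_(T in s) c T *: ev R T = \sum_T c T *: ev R T.
Proof.
move=> /fintype.subsetP cs; rewrite [RHS](bigID (mem s)) /=.
rewrite [X in _ = _ + X]big1 ?addr0 // => T sT.
have [->|cT] := eqVneq (c T) 0; first by rewrite scale0r.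
by case/negP: sT; apply: cs; rewrite inE.
Qed.

Lemma pconeP s x : pcone s x <->
  exists c, [/\ forall T, 0 <= c T, supp c \subset s
                & x = \sum_T c T *: ev R T].
Proof.
split=> [[c c0 ->]|[c [c0 cs ->]]]; last by exists c => //; rewrite sum_supp.
have cs : supp (fun T => if T \in s then c T else 0) \subset s.
  by apply/fintype.subsetP => T; rewrite inE; case: ifP => //; rewrite eqxx.
exists (fun T => if T \in s then c T else 0); split=> // [T|].
  by case: ifP.
by rewrite -(sum_supp cs); apply: eq_bigr => T ->.
Qed.

Lemma represents_ev D T : [set T]%SET \in D ->
  represents D (fun U => (U == T)%:R) (ev R T).
Proof.
move=> DT; split=> [U||]; first exact: ler0n.
  rewrite (_ : supp _ = [set T]%SET) //; apply/setP => U; rewrite !inE.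
  by case: (U == T); rewrite ?oner_eq0 ?eqxx.
by rewrite (bigD1 T) //= eqxx scale1r big1 ?addr0 // => U /negPf ->;
   rewrite scale0r.
Qed.

Lemma represents_pair D A B : smooth_complex D -> [set A; B]%SET \in D ->
  represents D (fun U => (U == A)%:R + (U == B)%:R) (ev R A + ev R B).
Proof.
move=> sD DAB; have D1 T : T \in [set A; B]%SET -> [set T]%SET \in D.
  by move=> sT; apply: complex_sub sD _ _ DAB _; rewrite finset.sub1set.
split=> [T||]; first by rewrite addr_ge0 ?ler0n.
  apply: complex_sub sD _ _ DAB _; apply/fintype.subsetP => U.
  rewrite !inE; have [_|_] := eqVneq U A; first by [].
  by have [_|_] := eqVneq U B; rewrite ?addr0 ?eqxx.
have [_ _ EA] := represents_ev (D1 _ (finset.set21 A B)).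
have [_ _ EB] := represents_ev (D1 _ (finset.set22 A B)).
rewrite {1}EA {1}EB.
by rewrite -big_split; apply: eq_bigr => T _; rewrite scalerDl.
Qed.

Section SmoothComplex.
Variables (D : {set {set {set I}}}) (sD : smooth_complex D).

Lemma complex_indep s : s \in D -> indep s.
Proof.
by move=> Ds; apply: unimodular_indep; [apply: complex_proper sD _ Ds|
   apply: complex_unimodular sD _ Ds].
Qed.

Lemma complex_supp s c x : s \in D -> represents D c x -> pcone s x ->
  supp c \subset s.
Proof.
move=> Ds cx /pconeP[d [d0 ds dE]].
have dx : represents D d x by split=> //; apply: complex_sub sD _ _ Ds ds.
suff -> : supp c = supp d by [].
by apply/setP => T; rewrite !inE (complex_uniq sD cx dx).
Qed.

Lemma complex_mem s t T : s \in D -> t \in D -> T \in t ->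
  pcone s (ev R T) -> T \in s.
Proof.
move=> Ds Dt tT sT.
have DT : [set T]%SET \in D.
  by apply: complex_sub sD _ _ Dt _; rewrite finset.sub1set.
have /fintype.subsetP := complex_supp Ds (represents_ev DT) sT; apply.
by rewrite inE eqxx oner_eq0.
Qed.

(** The unique representation of a common point has its support in both
    families. *)
Lemma pcone_setI s t : s \in D -> t \in D ->
  pcone s `&` pcone t = pcone (s :&: t)%SET.
Proof.
move=> Ds Dt; rewrite eqEsubset; split=> [x [sx tx]|x stx]; last first.
  by split; apply: pcone_sub stx; [apply: finset.subsetIl|apply: finset.subsetIr].
have [c cx] := complex_ex sD x; have [c0 _ xE] := cx.
apply/pconeP; exists c; split=> //.
by rewrite finset.subsetI !(complex_supp _ cx).
Qed.

Lemma fan_of_is_fan : is_fan (fan_of D).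
Proof.
split; first exact/finite_image/finite_finset.
- move=> _ [s /= Ds <-]; have is_ := complex_indep Ds.
  split; last exact: pcone_strongly_convex.
  exact/pcone_rational/indep_proper/is_.
- move=> _ F [s /= Ds <-] /pcone_face_sub[t ts ->]; exists t => //=.
  exact: complex_sub sD _ _ Ds ts.
- move=> _ _ [s /= Ds <-] [t /= Dt <-]; rewrite pcone_setI //.
  by split; apply: pcone_faceP; rewrite ?finset.subsetIl ?finset.subsetIr //;
     apply: complex_indep.
Qed.

Lemma fan_of_smooth : smooth (fan_of D).
Proof.
move=> _ [s /= Ds <-]; apply/smooth_cone_pcone; first exact: complex_indep.
exact: complex_unimodular sD _ Ds.
Qed.

(** The sets A n B and A u B form a chain, so their vectors lie in a cone of the
    complex. The sum of their representations there represents e_A + e_B, hence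
    equals the representation by A and B. So e_(A n B) is a combination of e_A
    and e_B, and testing it on one point of each region cut out by two crossing
    sets gives a contradiction. *)
Lemma complex_noncrossing s A B : s \in D -> A \in s -> B \in s ->
  noncrossing A B.
Proof.
move=> Ds sA sB; apply/or4P.
case: (boolP (A \subset B)) => [|/fintype.subsetPn[j jA jB]]; first by constructor.
case: (boolP (B \subset A)) => [|/fintype.subsetPn[k kB kA]]; first by constructor.
case: (boolP (A \subset ~: B)) => [|/fintype.subsetPn[i iA]]; first by constructor.
case: (boolP (~: A \subset B)) => [|/fintype.subsetPn[l]]; first by constructor.
rewrite !inE negbK => lA lB iB; exfalso.
have [|t Dt tP] := complex_chain sD (f := [set A :&: B; A :|: B]%SET).
  have sub : A :&: B \subset A :|: B.
    by apply: fintype.subset_trans (finset.subsetUl _ _); apply: finset.subsetIl.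
  by move=> S T; rewrite !inE => /orP[]/eqP-> /orP[]/eqP->; rewrite ?sub ?orbT //;
     rewrite fintype.subxx.
have [c [c0 ct cE]] : exists c, [/\ forall T, 0 <= c T, supp c \subset t &
    ev R (A :&: B) = \sum_T c T *: ev R T].
  by apply/pconeP/tP; rewrite !inE eqxx.
have [d [d0 dt dE]] : exists d, [/\ forall T, 0 <= d T, supp d \subset t &
    ev R (A :|: B) = \sum_T d T *: ev R T].
  by apply/pconeP/tP; rewrite !inE eqxx orbT.
have Eg : represents D (fun U => (U == A)%:R + (U == B)%:R) (ev R A + ev R B).
  apply: represents_pair => //; apply: complex_sub sD _ _ Ds _.
  by rewrite finset.subUset !finset.sub1set sA.
have Ecd : represents D (fun T => c T + d T) (ev R A + ev R B).
  split=> [T||]; first by rewrite addr_ge0.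
    apply: complex_sub sD _ _ Dt _; apply/fintype.subsetP => U.
    rewrite inE => cd; have := fintype.subsetP ct U; have := fintype.subsetP dt U.
    rewrite !inE; have [dU _|_ tU _] := eqVneq (d U) 0; last exact: tU.
    by apply; apply: contraNneq cd => ->; rewrite dU addr0.
  rewrite ev_modular cE dE -big_split; apply: eq_bigr => T _.
  by rewrite scalerDl.
have gE := complex_uniq sD Ecd Eg.
have cz T : T != A -> T != B -> c T = 0.
  move=> /negPf TA /negPf TB; have /eqP := gE T; rewrite TA TB addr0.
  by rewrite paddr_eq0 // => /andP[/eqP].
have AB : B != A by apply: contraNneq kA => <-.
have {}cE : ev R (A :&: B) = c A *: ev R A + c B *: ev R B.
  rewrite cE (bigD1 A) //= (bigD1 B) //= addrA big1 ?addr0 // => T.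
  by move=> /andP[TA TB]; rewrite cz // scale0r.
have E x := congr1 (coord_diff x l) cE.
have := E i; have := E j; have := E k.
rewrite !raddfD /= !linearZ /= !coord_diff_ev !inE iA iB jA kB.
rewrite (negPf jB) (negPf kA) (negPf lA) (negPf lB) /=.
by lra.
Qed.

End SmoothComplex.
End Complexes.

Arguments complex_indep {R n D} sD {s} Ds.
Arguments complex_proper {R n D} _ {s} _.

(** * Star subdivision at a two-dimensional cone *)
Section Star.
Variables (R : realType) (n : nat).
Local Notation V := (quo R n).
Local Notation I := 'I_n.
Implicit Types (T A B X : {set I}) (s t f : {set {set I}}).
Implicit Types (D : {set {set {set I}}}) (c d : {set I} -> R).
Local Notation pcone := (@pcone R n).
Local Notation indep := (@indep R n).

(** Adding one basis vector to another is an elementary operation; phi translates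
    coordinates in the new basis into coordinates in the old one. *)
Lemma Zbasis_add_to (b : seq (quo int n)) (v w : quo int n) :
  Zbasis b -> v \in b -> w \in b -> v != w ->
  exists b', [/\ Zbasis b', v + w \in b'
               & forall z, z \in b -> z != v -> z \in b'].
Proof.
move=> Zb vb wb vw.
pose i : 'I_(size b) := Ordinal (etrans (index_mem _ _) vb).
pose j : 'I_(size b) := Ordinal (etrans (index_mem _ _) wb).
have vi : b`_i = v by apply: nth_index.
have wj : b`_j = w by apply: nth_index.
have ij : i != j by apply: contraNneq vw => ij; rewrite -vi -wj ij.
pose b' := set_nth 0 b i (v + w).
have size_b' : size b' = size b.
  by rewrite size_set_nth; apply/maxn_idPr; apply: ltn_ord.
have b'E k : b'`_k = if k == i then v + w else b`_k.
  by rewrite nth_set_nth.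
exists b'; split; last 2 first.
- by have := b'E i; rewrite eqxx => <-; apply: mem_nth; rewrite size_b'.
- move=> z zb zv; have -> : z = b'`_(index z b).
    rewrite b'E; case: eqP => [zi|_]; last by rewrite nth_index.
    by case/eqP: zv; rewrite -vi -zi nth_index.
  by apply: mem_nth; rewrite size_b' index_mem.
pose phi (c : {ffun 'I_(size b) -> int}) : {ffun 'I_(size b) -> int} :=
  [ffun k => c k + (k == j)%:R * c i].
pose psi (c : {ffun 'I_(size b) -> int}) : {ffun 'I_(size b) -> int} :=
  [ffun k => c k - (k == j)%:R * c i].
have phiK : cancel phi psi.
  move=> c; apply/ffunP => k; rewrite !ffunE (negPf ij) mul0r addr0.
  by rewrite addrK.
have psiK : cancel psi phi.
  move=> c; apply/ffunP => k; rewrite !ffunE (negPf ij) mul0r subr0.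
  by rewrite subrK.
have sumE (c : {ffun 'I_(size b) -> int}) :
    \sum_(k < size b) b'`_k *~ c k = \sum_(k < size b) b`_k *~ phi c k.
  under [RHS]eq_bigr do rewrite ffunE mulrzDr.
  rewrite big_split /= [X in _ = _ + X](bigD1 j) //= eqxx mul1r wj.
  rewrite [X in _ + (_ + X)]big1 => [|k /negPf ->]; last by rewrite mul0r mulr0z.
  rewrite addr0 (bigD1 i) //= [in RHS](bigD1 i) //= b'E eqxx mulrzDl vi.
  rewrite -!addrA; congr (_ + _); rewrite addrC; congr (_ + _).
  by apply: eq_bigr => k /negPf ki; rewrite b'E -val_eqE /= in ki *;
     rewrite ki.
suff : forall z, exists! c : {ffun 'I_(size b) -> int},
    z = \sum_(k < size b) b'`_k *~ c k.
  by rewrite /Zbasis; move: (size b) size_b' => m <-.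
move=> z; have [c [cE c_uniq]] := Zb z; exists (psi c); split.
  by rewrite sumE psiK.
by move=> d; rewrite sumE => /c_uniq ->.
Qed.

(** The families of the star subdivision at the cone over A and B, where X is the
    set with e_X = e_A + e_B. *)
Definition star D A B X : {set {set {set I}}} :=
  [set s : {set {set I}} | ~~ ([set A; B]%SET \subset s) &&
     ((s \in D) || [exists t in D, ([set A; B]%SET \subset t) &&
                                   (s \subset X |: t)])]%SET.

Section StarComplex.
Variables (D : {set {set {set I}}}) (A B X : {set I}).
Hypotheses (sD : smooth_complex R D) (AB : A != B).
Hypotheses (DAB : [set A; B]%SET \in D) (pX : proper_set X).
Hypothesis XE : ev int X = ev int A + ev int B.

Lemma ev_center : ev R X = ev R A + ev R B.
Proof.
apply: coord_diff_inj => i j; rewrite raddfD /= -!latt_ev !coord_diff_latt.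
by rewrite -rmorphD -[_ + _](raddfD (coord_diff i j)) XE.
Qed.

Lemma proper_left : proper_set A.
Proof. by apply: (complex_proper sD DAB); rewrite !inE eqxx. Qed.

Lemma proper_right : proper_set B.
Proof. by apply: (complex_proper sD DAB); rewrite !inE eqxx orbT. Qed.

Lemma center_neq_left : X != A.
Proof.
apply: contraTneq (ev_neq0 R proper_right) => E; have := ev_center.
by rewrite E -[LHS]addr0 => /addrI <-; rewrite eqxx.
Qed.

Lemma center_neq_right : X != B.
Proof.
apply: contraTneq (ev_neq0 R proper_left) => E; have := ev_center.
by rewrite E -[LHS]add0r => /addIr <-; rewrite eqxx.
Qed.

(** Otherwise e_X would be represented both by X alone and by A and B. *)
Lemma center_notin s : s \in D -> X \notin s.
Proof.
move=> Ds; apply/negP => Xs.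
have D1 : [set X]%SET \in D.
  by apply: complex_sub sD _ _ Ds _; rewrite finset.sub1set.
have := represents_ev R D1; rewrite ev_center.
move=> /(complex_uniq sD (represents_pair sD DAB))/(_ A).
rewrite eqxx (negPf AB) addr0 eq_sym (negPf center_neq_left) => /eqP.
by rewrite oner_eq0.
Qed.

Lemma pcone_pair_sub s : s \in D ->
  pcone [set A; B]%SET `<=` pcone s <-> [set A; B]%SET \subset s.
Proof.
move=> Ds; split=> [sub|]; last exact: pcone_sub.
apply/fintype.subsetP => T TAB; apply: (complex_mem sD Ds DAB TAB).
exact/sub/pcone_ev.
Qed.

Lemma star_centerE : star_center (pcone [set A; B]%SET) = ev int X.
Proof.
rewrite /star_center ray_gens_pcone; last exact: (complex_indep sD DAB).
rewrite (sum_evs R); last exact: (complex_proper sD DAB).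
by rewrite big_setU1 ?inE // big_set1 XE.
Qed.

Lemma star_proper s : s \in star D A B X -> proper_family s.
Proof.
rewrite inE => /andP[_ /orP[Ds|/exists_inP[t Dt /andP[_ /fintype.subsetP st]]]].
  exact: (complex_proper sD Ds).
move=> T /st; rewrite !inE => /orP[/eqP -> //|].
exact: (complex_proper sD Dt).
Qed.

(** This is the identification of the geometric star subdivision: the center of
    the cone over A and B is e_X, and the sets of generators allowed by the
    definition correspond to the families of the new complex. *)
Lemma star_fan :
  star_subdivision (@fan_of R n D) (pcone [set A; B]%SET) =
  @fan_of R n (star D A B X).
Proof.
rewrite eqEsubset; split=> C.
  move=> [[[s /= Ds <-] nAB]|[_ [[t /= Dt <-] /(pcone_pair_sub Dt) ABt]]].
    exists s => //=; rewrite inE Ds andbT; apply/negP => ABs; apply: nAB.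
    exact/pcone_pair_sub.
  move=> [F [FE nF] <-]; move: FE nF; rewrite star_centerE.
  rewrite (ray_gens_pcone (complex_indep sD Dt)).
  rewrite (ray_gens_pcone (complex_indep sD DAB)).
  move=> FE nF; pose s := [set U in X |: t | `[< F (ev int U) >]]%SET.
  have Fs : F = evs s.
    rewrite eqEsubset; split=> v.
      move=> Fv; have [[U /= tU UE]|XE'] := FE _ Fv.
        by exists U; rewrite //= !inE tU orbT UE; apply/asboolP.
      by exists X; rewrite //= !inE eqxx -XE'; apply/asboolP.
    by move=> [U /=]; rewrite inE => /andP[_ /asboolP FU <-].
  have ss : s \in star D A B X.
    rewrite inE; apply/andP; split.
      apply/negP => /fintype.subsetP ABs; apply: nF => _ [U /= /ABs Us <-].
      by rewrite Fs; exists U.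
    apply/orP; right; apply/exists_inP; exists t => //; rewrite ABt.
    by apply/fintype.subsetP => U; rewrite inE => /andP[].
  by exists s => //; rewrite Fs cone_evs //; apply: star_proper ss.
move=> [s /= ss <-]; have ps := star_proper ss; move: ss; rewrite inE.
move=> /andP[nABs /orP[Ds|/exists_inP[t Dt /andP[ABt st]]]].
  by left; split; [exists s|move=> /(pcone_pair_sub Ds); apply/negP].
right; exists (pcone t); first by split; [exists t|exact/pcone_pair_sub].
exists (evs s); last exact: cone_evs.
rewrite star_centerE (ray_gens_pcone (complex_indep sD Dt)).
rewrite (ray_gens_pcone (complex_indep sD DAB)).
split.
  move=> _ [U /= /(fintype.subsetP st) UXt <-]; move: UXt; rewrite !inE.
  by move=> /orP[/eqP ->|tU]; [right|left; exists U].
move=> ABs; case/negP: nABs; apply/fintype.subsetP => U UAB.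
have [|W /= Ws /(ev_int_inj R (ps _ Ws)) <-//] := ABs (ev int U).
by exists U.
Qed.

Lemma star_supp (c : {set I} -> R) : supp c \in star D A B X ->
  c A = 0 \/ c B = 0.
Proof.
rewrite inE => /andP[/fintype.subsetPn[T]]; rewrite !inE negbK.
by move=> /orP[]/eqP -> /eqP; [left|right].
Qed.

(** Adding a multiple of e to the coefficients does not change the vector, since
   e_A + e_B - e_X = 0. Representations in the old and in the new complex differ
   by such a multiple. *)
Let e T : R := (T == A)%:R + (T == B)%:R - (T == X)%:R.

Let eA : e A = 1.
Proof.
by rewrite /e eqxx (negPf AB) eq_sym (negPf center_neq_left) addr0 subr0.
Qed.
Let eB : e B = 1.
Proof.
by rewrite /e eqxx ![B == _]eq_sym (negPf AB) (negPf center_neq_right) add0r subr0.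
Qed.
Let eX : e X = -1.
Proof.
rewrite /e eqxx (negPf center_neq_left) (negPf center_neq_right).
by rewrite addr0 add0r.
Qed.
Let e0 T : T != A -> T != B -> T != X -> e T = 0.
Proof. by rewrite /e => /negPf -> /negPf -> /negPf ->; rewrite addr0 subr0. Qed.

Let sum_e (c : {set I} -> R) (m : R) :
  \sum_T (c T + m * e T) *: ev R T = \sum_T c T *: ev R T.
Proof.
under eq_bigr do rewrite scalerDl -scalerA.
rewrite big_split /= -scaler_sumr -[RHS]addr0; congr (_ + _).
rewrite (_ : \sum_T _ = 0) ?scaler0 // /e.
under eq_bigr do rewrite scalerBl scalerDl.
have S U : \sum_T ((T == U)%:R : R) *: ev R T = ev R U.
  rewrite (bigD1 U) //= eqxx scale1r big1 ?addr0 // => T /negPf ->.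
  by rewrite scale0r.
by rewrite sumrB big_split /= !S ev_center subrr.
Qed.

(** Subtract min(c A, c B) from the coefficients of A and B, and give it to X. *)
Lemma star_represents x : exists c, represents (star D A B X) c x.
Proof.
have [c [c0 Dc xE]] := complex_ex sD x.
have cX : c X = 0 by apply/eqP; have := center_notin Dc; rewrite inE negbK.
pose m := Num.min (c A) (c B).
have m0 : 0 <= m by rewrite le_min !c0.
have mA : m <= c A by rewrite ge_min lexx.
have mB : m <= c B by rewrite ge_min lexx orbT.
pose d T := c T + - m * e T.
have dA : d A = c A - m by rewrite /d eA mulr1.
have dB : d B = c B - m by rewrite /d eB mulr1.
have dX : d X = m by rewrite /d eX cX mulrN1 opprK add0r.
have dT T : T != A -> T != B -> T != X -> d T = c T.
  by move=> TA TB TX; rewrite /d e0 // mulr0 addr0.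
exists d; split; last by rewrite sum_e.
  move=> T; have [->|TA] := eqVneq T A; first by rewrite dA subr_ge0.
  have [->|TB] := eqVneq T B; first by rewrite dB subr_ge0.
  by have [->|TX] := eqVneq T X; [rewrite dX|rewrite dT].
rewrite inE; apply/andP; split.
  have : (d A == 0) || (d B == 0).
    by rewrite dA dB !subr_eq0 /m; case: leP; rewrite eqxx ?orbT.
  move=> /orP[]d0; apply/fintype.subsetPn; [exists A|exists B];
    by rewrite !inE ?eqxx ?orbT ?d0.
have [cAB|cAB] := boolP ([set A; B]%SET \subset supp c).
  apply/orP; right; apply/exists_inP; exists (supp c) => //; rewrite cAB /=.
  apply/fintype.subsetP => T; rewrite !inE; have [//|TX] := eqVneq T X; rewrite /=.
  have [->|TA] := eqVneq T A.
    by move=> _; have := fintype.subsetP cAB A (finset.set21 A B); rewrite inE.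
  have [->|TB] := eqVneq T B.
    by move=> _; have := fintype.subsetP cAB B (finset.set22 A B); rewrite inE.
  by rewrite dT.
suff m00 : m = 0.
  suff -> : supp d = supp c by rewrite Dc.
  by apply/setP => T; rewrite !inE /d m00 oppr0 mul0r addr0.
have : (c A == 0) || (c B == 0).
  by move/fintype.subsetPn: cAB => [T]; rewrite !inE negbK => /orP[]/eqP -> ->;
     rewrite ?orbT.
by move=> /orP[]/eqP E; apply/eqP; rewrite eq_le m0 andbT -E.
Qed.

(** Redistributing the coefficient of X to A and B yields the representation in
    the old complex. It can be undone: A and B do not both occur in a new family,
    so the coefficient of X is the smaller of the old coefficients of A and B. *)
Lemma star_uniq x (c d : {set I} -> R) : represents (star D A B X) c x ->
  represents (star D A B X) d x -> c =1 d.
Proof.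
have pull c' : represents (star D A B X) c' x ->
    represents D (fun T => c' T + c' X * e T) x.
  move=> [c0 Dc ->]; split; last by rewrite sum_e.
    move=> T; have [->|TA] := eqVneq T A; first by rewrite eA mulr1 addr_ge0.
    have [->|TB] := eqVneq T B; first by rewrite eB mulr1 addr_ge0.
    have [->|TX] := eqVneq T X; first by rewrite eX mulrN1 subrr.
    by rewrite e0 // mulr0 addr0.
  move: Dc; rewrite inE => /andP[_ /orP[Dc|/exists_inP[t Dt /andP[ABt ct]]]].
    have cX : c' X = 0 by apply/eqP; have := center_notin Dc; rewrite inE negbK.
    suff -> : supp (fun T => c' T + c' X * e T) = supp c' by [].
    by apply/setP => T; rewrite !inE cX mul0r addr0.
  apply: complex_sub sD _ _ Dt _; apply/fintype.subsetP => T; rewrite inE.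
  have [->|TA] := eqVneq T A.
    by move=> _; apply: (fintype.subsetP ABt); rewrite !inE eqxx.
  have [->|TB] := eqVneq T B.
    by move=> _; apply: (fintype.subsetP ABt); rewrite !inE eqxx orbT.
  have [->|TX] := eqVneq T X; first by rewrite eX mulrN1 subrr eqxx.
  rewrite e0 // mulr0 addr0 => cT; have := fintype.subsetP ct T.
  by rewrite !inE (negPf TX); apply.
move=> cx dx; have E := complex_uniq sD (pull _ cx) (pull _ dx).
have [[c0 sc _] [d0 sd _]] := (cx, dx).
have cdX : c X = d X.
  have := E A; have := E B; rewrite /= eA eB !mulr1.
  have := c0 A; have := c0 B; have := d0 A; have := d0 B.
  by case: (star_supp sc) (star_supp sd) => -> [] ->; lra.
by move=> T; have := E T; rewrite /= cdX => /addIr.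
Qed.

Lemma star_unimodular s : s \in star D A B X -> unimodular s.
Proof.
rewrite inE => /andP[nAB /orP[Ds|/exists_inP[t Dt /andP[ABt st]]]].
  exact: (complex_unimodular sD Ds).
have [b Zb tb] := complex_unimodular sD Dt.
have Ab : ev int A \in b by apply/tb/(fintype.subsetP ABt)/finset.set21.
have Bb : ev int B \in b by apply/tb/(fintype.subsetP ABt)/finset.set22.
have vAB : ev int A != ev int B.
  by apply: contraNneq AB => /(ev_int_inj R proper_left) ->.
have vT U T : proper_set U -> T != U -> ev int T != ev int U.
  by move=> pU TU; apply: contraNneq TU => /esym/(ev_int_inj R pU) ->.
have /fintype.subsetPn[T] := nAB; rewrite !inE => /orP[]/eqP -> nT.
  have [b' [Zb' Xb' bb']] := Zbasis_add_to Zb Ab Bb vAB.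
  exists b' => // U sU; have := fintype.subsetP st U sU; rewrite !inE.
  move=> /orP[/eqP ->|/tb tU]; first by rewrite XE.
  by apply: bb' => //; apply: vT proper_left _; apply: contraNneq nT => <-.
rewrite eq_sym in vAB.
have [b' [Zb' Xb' bb']] := Zbasis_add_to Zb Bb Ab vAB.
exists b' => // U sU; have := fintype.subsetP st U sU; rewrite !inE.
move=> /orP[/eqP ->|/tb tU]; first by rewrite XE addrC.
by apply: bb' => //; apply: vT proper_right _; apply: contraNneq nT => <-.
Qed.

(** The chain condition depends on the choice of A and B, and is established
    separately for a suitable choice. *)
Lemma star_complex :
  (forall f, is_chain f -> exists2 s, s \in star D A B X &
     forall T, T \in f -> pcone s (ev R T)) ->
  smooth_complex R (star D A B X).
Proof.
move=> chainP; split=> //; last 1 first.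
- exact: star_uniq.
- move=> s t ss ts; move: ss; rewrite !inE => /andP[nAB sD'].
  apply/andP; split.
    by apply: contra nAB => ABt; apply: fintype.subset_trans ABt ts.
  case/orP: sD' => [Ds|/exists_inP[r Dr /andP[ABr sr]]].
    by rewrite (complex_sub sD Ds ts).
  apply/orP; right; apply/exists_inP; exists r => //; rewrite ABr /=.
  exact: fintype.subset_trans ts sr.
- exact: star_proper.
- exact: star_unimodular.
- exact: star_represents.
Qed.

End StarComplex.
End Star.

(** * Points that a noncrossing family does not separate *)
Section Noncrossing.
Variables (R : realType) (n : nat).
Local Notation V := (quo R n).
Local Notation I := 'I_n.
Implicit Types (S T A B K X : {set I}) (s t f F L : {set {set I}}).

(** If L covered K, then the maximal members of L would partition K, so e_K would
    be the sum of their vectors, and u would vanish at it. *)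
Lemma uncovered_point L K (u : {scalar V}) :
  {in L, forall S : {set I}, S \subset K} ->
  {in L &, forall S T : {set I}, [|| S \subset T, T \subset S | S \subset ~: T]} ->
  {in L, forall S, u (ev R S) = 0} -> u (ev R K) != 0 ->
  exists2 k, k \in K & forall S, S \in L -> k \notin S.
Proof.
move=> LK lam Lu uK; apply: contrapT => nk.
pose M := [set S in L | [forall (T | T \in L), (S \subset T) ==> (T == S)]]%SET.
have coverM : finset.cover M = K.
  apply/eqP; rewrite finset.eqEsubset.
  apply/andP; split; apply/fintype.subsetP => k.
    move=> /finset.bigcupP[S]; rewrite inE => /andP[SL _].
    exact: (fintype.subsetP (LK S SL)).
  move=> kK; have [S SL kS] : exists2 S, S \in L & k \in S.
    apply: contrapT => nS; apply: nk; exists k => // S SL.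
    by apply/negP => kS; apply: nS; exists S.
  have S0 : [pred T : {set I} | (T \in L) && (k \in T)] S by rewrite /= SL.
  case: (arg_maxnP (fun T : {set I} => #|T|) S0) => T /andP[TL kT] Tmax.
  apply/finset.bigcupP; exists T => //; rewrite inE TL; apply/forall_inP => T' T'L.
  apply/implyP => TT'; rewrite eq_sym finset.eqEcard TT' /=.
  by apply: Tmax; rewrite /= T'L (fintype.subsetP TT').
have trivM : finset.trivIset M.
  apply/finset.trivIsetP => S T; rewrite !inE.
  move=> /andP[SL /forall_inP Smax] /andP[TL /forall_inP Tmax] ST.
  rewrite finset.disjoints_subset; have /or3P[ST'|TS'|//] := lam S T SL TL.
    by have /implyP/(_ ST') := Smax T TL; rewrite eq_sym (negPf ST).
  by have /implyP/(_ TS') := Tmax S SL; rewrite (negPf ST).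
case/eqP: uK; rewrite ev_sum -coverM big_trivIset // raddf_sum big1 // => S.
by rewrite inE => /andP[/Lu uS _]; rewrite -ev_sum.
Qed.

Let subCset A B : (~: A \subset B) = (~: B \subset A).
Proof. by rewrite -{1}(finset.setCK B) finset.setCS. Qed.

Lemma noncrossingC A B : noncrossing A B = noncrossing B A.
Proof. by rewrite /noncrossing orbCA finset.subsetC subCset. Qed.

Lemma noncrossing_setC A B : noncrossing A (~: B) = noncrossing A B.
Proof.
rewrite /noncrossing finset.setCK finset.setCS (subCset B A).
by case: (A \subset B); case: (B \subset A); rewrite /= ?orbT ?orbF // orbC.
Qed.

(** Members and complements of members that lie strictly inside K are laminar:
    the union of two of them is inside K, hence is not [n], which leaves nested
    or disjoint. *)
Lemma uncovered_point_upto_setC F K (u : {scalar V}) :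
  {in F &, forall S T, noncrossing S T} -> K != [set: I]%SET ->
  (forall S, S \proper K -> (S \in F) || (~: S \in F) -> u (ev R S) = 0) ->
  u (ev R K) != 0 ->
  exists2 k, k \in K &
    forall S, S \proper K -> (S \in F) || (~: S \in F) -> k \notin S.
Proof.
move=> ncF KT u0 uK.
pose L := [set S : {set I} | (S \proper K) && ((S \in F) || (~: S \in F))]%SET.
have [|S T||k kK kL] := @uncovered_point L K u _ _ _ uK.
- by move=> S; rewrite inE => /andP[/proper_sub].
- rewrite !inE => /andP[SK SF] /andP[TK TF].
  have nc : noncrossing S T.
    case/orP: SF => SF; case/orP: TF => TF; first exact: ncF.
    + by rewrite -noncrossing_setC ncF.
    + by rewrite noncrossingC -noncrossing_setC ncF.
    + by rewrite -noncrossing_setC noncrossingC -noncrossing_setC ncF.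
  case/or4P: nc => [->|->|->|nST]; rewrite ?orbT //.
  case/negP: KT; rewrite -finset.subTset -(finset.setUCr S) finset.subUset.
  by rewrite (proper_sub SK) (fintype.subset_trans nST) // proper_sub.
- by move=> S; rewrite inE => /andP[SK SF]; apply: u0.
by exists k => // S SK SF; apply: kL; rewrite inE SK.
Qed.

(** The points a, b and m are taken in A, in B and outside A u B, avoiding all
    members and complements of members that lie strictly inside A, B and the
    complement of A u B respectively. A set T of F that is neither a subset of A or
    B, nor the complement of such a subset, contains A or is disjoint from it, and
    likewise for B. Containing one and being disjoint from the other is excluded
    by maximality, so T or its complement avoids A u B. *)
Lemma separating_points F A B (uA uB : {scalar V}) :
  {in F, forall S, proper_set S} -> {in F &, forall S T, noncrossing S T} ->
  A \in F -> B \in F -> A \subset ~: B ->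
  uA (ev R A) != 0 -> (forall T, T \in F -> T != A -> uA (ev R T) = 0) ->
  uB (ev R B) != 0 -> (forall T, T \in F -> T != B -> uB (ev R T) = 0) ->
  (forall T, T \in F -> A \proper T -> ~~ (T \subset ~: B)) ->
  (forall T, T \in F -> B \proper T -> ~~ (T \subset ~: A)) ->
  exists a b m, [/\ a \in A, b \in B, m \notin A :|: B &
    forall T, T \in F -> T != A -> T != B ->
      (a \in T) = (m \in T) /\ (b \in T) = (m \in T)].
Proof.
move=> pF ncF AF BF dAB uAA uA0 uBB uB0 maxA maxB.
have core K (u : {scalar V}) : K \in F -> u (ev R K) != 0 ->
    (forall T, T \in F -> T != K -> u (ev R T) = 0) ->
    exists2 k, k \in K &
    forall S, S \proper K -> (S \in F) || (~: S \in F) -> k \notin S.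
  move=> KF uK u0; have /andP[Kn0 KnT] := pF K KF.
  apply: uncovered_point_upto_setC uK => // S SK /orP[SF|SF].
    by apply: u0 => //; rewrite (proper_neq SK).
  apply/eqP; rewrite -oppr_eq0 -raddfN -evC; apply/eqP/u0 => //.
  apply: contraNneq KnT => E; rewrite -finset.subTset -(finset.setUCr S).
  by rewrite finset.subUset proper_sub //= E.
have [a aA aP] := core A uA AF uAA uA0.
have [b bB bP] := core B uB BF uBB uB0.
have dP i : i \in A -> i \notin B.
  by move=> iA; have := fintype.subsetP dAB i iA; rewrite inE.
have BA : B != A by apply: contraNneq (dP a aA) => ->.
have evX : ev R (A :|: B) = ev R A + ev R B.
  by rewrite ev_modular (disjoint_setI0 _) ?ev0 ?add0r // finset.disjoints_subset.
have uX : uA (ev R (A :|: B)) != 0 by rewrite evX raddfD /= (uA0 B) ?addr0.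
have [m] : exists2 m, m \in ~: (A :|: B) &
    forall S, S \proper ~: (A :|: B) -> (S \in F) || (~: S \in F) -> m \notin S.
  apply: (@uncovered_point_upto_setC F _ uA) => //.
  - apply/negP => /eqP E; have : a \in ~: (A :|: B) by rewrite E inE.
    by rewrite !inE aA.
  - move=> S SX SF; have aS : a \notin S.
      apply/negP => /(fintype.subsetP (proper_sub SX)).
      by rewrite !inE aA.
    case/orP: SF => SF.
      by apply: uA0 => //; apply: contraNneq aS => ->.
    apply/eqP; rewrite -oppr_eq0 -raddfN -evC; apply/eqP/uA0 => //.
    apply: contraTneq (bB) => E; apply: dP; rewrite -E inE; apply/negP.
    by move=> /(fintype.subsetP (proper_sub SX)); rewrite !inE bB orbT.
  - by rewrite evC raddfN oppr_eq0.
rewrite !inE negb_or => /andP[mA mB] mP.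
exists a, b, m; split=> //; first by rewrite inE negb_or mA.
move=> T TF TA TB.
have bA : b \notin A by apply: contraL bB; apply: dP.
have aB : a \notin B := dP a aA.
have TX : T != A :|: B by apply: contraNneq uX => <-; rewrite uA0.
have TnC K (u : {scalar V}) : u (ev R K) != 0 -> u (ev R T) = 0 -> ~: T != K.
  move=> uK uT; apply: contraNneq uK => <-.
  by rewrite evC raddfN /= oppr_eq0 uT.
have TnA := TnC A uA uAA (uA0 _ TF TA).
have TnB := TnC B uB uBB (uB0 _ TF TB).
have inside K k : k \notin K -> T \subset K -> k \notin T.
  by move=> kK /fintype.subsetP TK; apply: contra kK; apply: TK.
have outside K k : k \notin K -> ~: T \subset K -> k \in T.
  move=> kK /fintype.subsetP TK; apply: contraNT kK => kT; apply: TK.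
  by rewrite inE.
have TCF : (~: T \in F) || (~: ~: T \in F) by rewrite finset.setCK TF orbT.
have TF' : (T \in F) || (~: T \in F) by rewrite TF.
have sub_neq K S : S \subset K -> S != K -> S \proper K.
  by rewrite finset.properEneq => -> ->.
have in_A : T \subset A -> (a \in T) = (m \in T) /\ (b \in T) = (m \in T).
  move=> sTA; rewrite (negPf (inside A m mA sTA)) (negPf (inside A b bA sTA)).
  by rewrite (negPf (aP T (sub_neq _ _ sTA TA) TF')).
have in_B : T \subset B -> (a \in T) = (m \in T) /\ (b \in T) = (m \in T).
  move=> sTB; rewrite (negPf (inside B m mB sTB)) (negPf (inside B a aB sTB)).
  by rewrite (negPf (bP T (sub_neq _ _ sTB TB) TF')).
have out_A : ~: T \subset A -> (a \in T) = (m \in T) /\ (b \in T) = (m \in T).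
  move=> sTA; rewrite (outside A m mA sTA) (outside A b bA sTA).
  by have := aP _ (sub_neq _ _ sTA TnA) TCF; rewrite inE negbK => ->.
have out_B : ~: T \subset B -> (a \in T) = (m \in T) /\ (b \in T) = (m \in T).
  move=> sTB; rewrite (outside B m mB sTB) (outside B a aB sTB).
  by have := bP _ (sub_neq _ _ sTB TnB) TCF; rewrite inE negbK => ->.
have /or4P[//|sAT|dTA|//] := ncF T A TF AF.
  have pAT : A \proper T by rewrite finset.properEneq eq_sym TA.
  have /or4P[//|sBT|dTB|//] := ncF T B TF BF; last first.
    by have := maxA T TF pAT; rewrite dTB.
  have sXT : A :|: B \subset T by rewrite finset.subUset sAT.
  rewrite (fintype.subsetP sAT _ aA) (fintype.subsetP sBT _ bB).
  have /mP/(_ TCF) : ~: T \proper ~: (A :|: B).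
    by rewrite finset.properC finset.properEneq eq_sym TX.
  by rewrite inE negbK => ->.
have /or4P[//|sBT|dTB|//] := ncF T B TF BF.
  have pBT : B \proper T by rewrite finset.properEneq eq_sym TB.
  by have := maxB T TF pBT; rewrite dTA.
have sTX : T \subset ~: (A :|: B) by rewrite finset.setCU finset.subsetI dTA.
have TXC : T != ~: (A :|: B).
  apply: contraNneq uX => E; have := uA0 T TF TA.
  by rewrite E evC raddfN => /eqP; rewrite oppr_eq0.
have out i : i \in A :|: B -> i \notin T.
  by move=> iX; apply/negP => /(fintype.subsetP sTX); rewrite inE iX.
rewrite (negPf (mP T (sub_neq _ _ sTX TXC) TF')).
by rewrite (negPf (out a _)) ?(negPf (out b _)) // inE ?aA ?bB ?orbT.
Qed.

End Noncrossing.

(** * A subdivision that stays refined by the braid fan *)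
Section Step.
Variables (R : realType) (n : nat).
Local Notation V := (quo R n).
Local Notation I := 'I_n.
Implicit Types (S T A B K L X : {set I}) (s t f F : {set {set I}}).
Implicit Types (D : {set {set {set I}}}) (c d : {set I} -> R).
Local Notation pcone := (@pcone R n).

(** Here c A e_A + c B e_B = c A e_X + (c B - c A) e_B. *)
Lemma pcone_replace s A B X c : A \in s -> B \in s -> A != B ->
  ev R X = ev R A + ev R B -> (forall T, 0 <= c T) -> c A <= c B ->
  pcone (X |: s :\ A)%SET (\sum_(T in s) c T *: ev R T).
Proof.
move=> sA sB AB XE c0 cAB.
have [C0 CD CZ] := pcone_convex R (X |: s :\ A)%SET.
have BsA : B \in s :\ A by rewrite !inE eq_sym AB.
rewrite (bigD1 A) //= (bigD1 B) /=; last by rewrite sB eq_sym.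
rewrite addrA; apply: (CD).
  rewrite (_ : _ + _ = c A *: ev R X + (c B - c A) *: ev R B).
    apply: (CD); apply: (CZ) => //; rewrite ?subr_ge0 //.
      by apply: pcone_ev; rewrite !inE eqxx.
    by apply: pcone_ev; rewrite inE BsA orbT.
  by rewrite XE scalerDr scalerBl -addrA [_ + (_ - _)]addrC subrK.
apply: convex_cone_sum (pcone_convex R _) _ => T /andP[/andP[sT TA] _].
by apply: (CZ) => //; apply: pcone_ev; rewrite !inE sT TA orbT.
Qed.

(** On the cone over s, the functionals x_a - x_m and x_b - x_m are the
    coordinates of e_A and e_B up to the common sign g. On the members of a chain
    the difference x_a - x_b has constant sign, as the smallest member containing
    one point but not the other decides which of the two can be larger. So one of
    the two halves of the subdivided cone contains all the vectors of the
    chain. *)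
Lemma star_chain D A B X : smooth_complex R D -> A != B ->
  [set A; B]%SET \in D -> proper_set X -> ev int X = ev int A + ev int B ->
  (forall s, s \in D -> [set A; B]%SET \subset s ->
     exists a b m, [/\ (a \in A) = ~~ (m \in A), (b \in B) = ~~ (m \in B),
       (b \in A) = (m \in A), (a \in B) = (m \in B) & (m \in A) = (m \in B)] /\
     forall T, T \in s -> T != A -> T != B ->
      (a \in T) = (m \in T) /\ (b \in T) = (m \in T)) ->
  forall f, is_chain f -> exists2 s, s \in star D A B X &
     forall T, T \in f -> pcone s (ev R T).
Proof.
move=> sD AB DAB pX XE sep f fchain.
have [s Ds fs] := complex_chain sD fchain.
have [ABs|ABs] := boolP ([set A; B]%SET \subset s); last first.
  by exists s => //; rewrite inE ABs Ds.
have [a [b [m [[aA bB bA aB mAB] sepT]]]] := sep s Ds ABs.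
have sA : A \in s by apply: (fintype.subsetP ABs); rewrite !inE eqxx.
have sB : B \in s by apply: (fintype.subsetP ABs); rewrite !inE eqxx orbT.
have XER' := ev_center R XE.
(* The sign is 1 for a disjoint pair and -1 for a pair with union [n]. *)
pose g : R := (~~ (m \in A))%:R - (m \in A)%:R.
have coefA c : coord_diff a m (\sum_(T in s) c T *: ev R T) = c A * g.
  rewrite raddf_sum (bigD1 A) //= linearZ /= coord_diff_ev aA.
  rewrite (bigD1 B) /=; last by rewrite sB eq_sym.
  rewrite linearZ /= coord_diff_ev aB subrr mulr0 add0r big1 ?addr0 //.
  move=> T /andP[/andP[sT TA] TB]; have [E _] := sepT T sT TA TB.
  by rewrite linearZ /= coord_diff_ev E subrr mulr0.
have coefB c : coord_diff b m (\sum_(T in s) c T *: ev R T) = c B * g.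
  rewrite raddf_sum (bigD1 A) //= linearZ /= coord_diff_ev bA subrr mulr0 add0r.
  rewrite (bigD1 B) /=; last by rewrite sB eq_sym.
  rewrite linearZ /= coord_diff_ev bB -mAB big1 ?addr0 //.
  move=> T /andP[/andP[sT TA] TB]; have [_ E] := sepT T sT TA TB.
  by rewrite linearZ /= coord_diff_ev E subrr mulr0.
have coefAB T c : ev R T = \sum_(U in s) c U *: ev R U ->
    (c A - c B) * g = (a \in T)%:R - (b \in T)%:R.
  move=> TE; have := coord_diff_ev R a m T; have := coord_diff_ev R b m T.
  by rewrite TE coefA coefB mulrBl => -> ->; rewrite opprB addrA subrK.
have starA : (X |: s :\ A)%SET \in star D A B X.
  rewrite inE; apply/andP; split.
    apply/fintype.subsetPn; exists A; first by rewrite !inE eqxx.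
    by rewrite !inE eqxx /= orbF eq_sym (center_neq_left sD DAB XE).
  apply/orP; right; apply/exists_inP; exists s => //; rewrite ABs /=.
  exact/finset.setUS/finset.subsetDl.
have starB : (X |: s :\ B)%SET \in star D A B X.
  rewrite inE; apply/andP; split.
    apply/fintype.subsetPn; exists B; first by rewrite !inE eqxx orbT.
    by rewrite !inE eqxx /= orbF eq_sym (center_neq_right sD DAB XE).
  apply/orP; right; apply/exists_inP; exists s => //; rewrite ABs /=.
  exact/finset.setUS/finset.subsetDl.
have allA : (forall T, T \in f -> ((a \in T)%:R - (b \in T)%:R) * g <= 0) ->
    forall T, T \in f -> pcone (X |: s :\ A)%SET (ev R T).
  move=> fab T fT; have [c c0 TE] := fs T fT; rewrite TE.
  apply: pcone_replace sA sB AB XER' c0 _.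
  have := coefAB T c TE; have := fab T fT; rewrite /g.
  by case: (m \in A) => /=; lra.
have allB : (forall T, T \in f -> 0 <= ((a \in T)%:R - (b \in T)%:R) * g) ->
    forall T, T \in f -> pcone (X |: s :\ B)%SET (ev R T).
  move=> fab T fT; have [c c0 TE] := fs T fT; rewrite TE.
  apply: (@pcone_replace s B A) => //; [by rewrite eq_sym|by rewrite addrC|].
  have := coefAB T c TE; have := fab T fT; rewrite /g.
  by case: (m \in A) => /=; lra.
have ab : (forall T, T \in f -> (a \in T)%:R <= (b \in T)%:R :> R) \/
          (forall T, T \in f -> (b \in T)%:R <= (a \in T)%:R :> R).
  apply: contrapT => /not_orP[/existsNP[S /not_implyP[fS Sab]]
                              /existsNP[T /not_implyP[fT Tab]]].
  move: Sab Tab; rewrite !ler_nat.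
  have [aS|aS] := boolP (a \in S); have [bS|bS] := boolP (b \in S) => // _.
  have [aT|aT] := boolP (a \in T); have [bT|bT] := boolP (b \in T) => // _.
  case/orP: (fchain S T fS fT) => /fintype.subsetP sub.
    by move: (sub a aS); rewrite (negPf aT).
  by move: (sub b bT); rewrite (negPf bS).
have gE : g = 1 \/ g = -1.
  by rewrite /g; case: (m \in A); rewrite /= ?subr0 ?sub0r; [right|left].
case: gE => gE; case: ab => ab.
- exists (X |: s :\ A)%SET => //; apply: allA => T /ab; rewrite gE; lra.
- exists (X |: s :\ B)%SET => //; apply: allB => T /ab; rewrite gE; lra.
- exists (X |: s :\ B)%SET => //; apply: allB => T /ab; rewrite gE; lra.
- exists (X |: s :\ A)%SET => //; apply: allA => T /ab; rewrite gE; lra.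
Qed.

(** Complementation on all subsets at once amounts to x |-> - x; the flag o allows
    pairs with union [n] to be treated as disjoint pairs. *)
Definition flip (o : bool) S := if o then ~: S else S.

Lemma flipK o : involutive (flip o).
Proof. by case: o => S; rewrite /flip ?finset.setCK. Qed.

Lemma mem_flip o S i : (i \in flip o S) = (i \in S) (+) o.
Proof. by case: o; rewrite /= ?addbT ?addbF ?inE. Qed.

Lemma proper_flip o S : proper_set (flip o S) = proper_set S.
Proof. by case: o; rewrite //= proper_setC. Qed.

Lemma ev_flip (K : comNzRingType) o S :
  ev K (flip o S) = if o then - ev K S else ev K S.
Proof. by case: o; rewrite //= evC. Qed.

Lemma noncrossing_flip o S T : noncrossing (flip o S) (flip o T) = noncrossing S T.
Proof.
by case: o; rewrite //= noncrossing_setC noncrossingC noncrossing_setC noncrossingC.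
Qed.

Lemma ev_setU_disjoint (K : comNzRingType) A B : A \subset ~: B ->
  ev K (A :|: B) = ev K A + ev K B.
Proof.
rewrite -finset.disjoints_subset => /disjoint_setI0 E.
by rewrite ev_modular E ev0 add0r.
Qed.

(** Among the pairs that are disjoint after flipping, one with union of maximal
    cardinality satisfies the maximality hypotheses of separating_points in every
    family that contains it: a violating set would give a pair with a larger
    union. *)
Lemma exists_star D s S T : smooth_complex R D ->
  s \in D -> S \in s -> T \in s -> ~~ (S \subset T) -> ~~ (T \subset S) ->
  exists A B X, [/\ A != B, [set A; B]%SET \in D, proper_set X,
    ev int X = ev int A + ev int B & smooth_complex R (star D A B X)].
Proof.
move=> sD Ds sS sT nST nTS.
pose P o (p : {set I} * {set I}) :=
  ([set flip o p.1; flip o p.2]%SET \in D) && (p.1 \subset ~: p.2).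
have DST : [set S; T]%SET \in D.
  by apply: complex_sub sD _ _ Ds _; rewrite finset.subUset !finset.sub1set sS.
have [o [p0 Pp0]] : exists o p, P o p.
  case/or4P: (complex_noncrossing sD Ds sS sT) => [||dST|cST].
  - by rewrite (negPf nST).
  - by rewrite (negPf nTS).
  - by exists false, (S, T); rewrite /P /= DST.
  - by exists true, (~: S, ~: T); rewrite /P /= !finset.setCK DST.
have {p0 Pp0} [[A' B']] :=
  arg_maxnP (fun p : {set I} * {set I} => #|p.1 :|: p.2|) Pp0.
rewrite /P /= => /andP[DAB dAB] ABmax.
pose A := flip o A'; pose B := flip o B'; rewrite -/A -/B in DAB.
pose X' := A' :|: B'; pose X := flip o X'.
have pA' : proper_set A' by rewrite -(proper_flip o) (proper_left sD DAB).
have pB' : proper_set B' by rewrite -(proper_flip o) (proper_right sD DAB).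
have AB : A != B.
  rewrite (inj_eq (can_inj (flipK o))).
  have /proper_setP[i [_ [iA _]]] := pA'.
  by apply: contraTneq iA => E; move: dAB; rewrite E => /fintype.subsetP/(_ i);
     rewrite inE; case: (i \in B') => // /(_ isT).
have XE : ev int X = ev int A + ev int B.
  by rewrite !ev_flip ev_setU_disjoint //; case: (o); rewrite // opprD.
have [u [uA u0]] := complex_indep sD DAB _ (finset.set21 A B).
have pX : proper_set X.
  rewrite proper_flip /proper_set; apply/andP; split.
    have /proper_setP[i [_ [iA _]]] := pA'.
    by apply/set0Pn; exists i; rewrite inE iA.
  apply/negP => /eqP XT; have := ev_center R XE.
  rewrite ev_flip XT evT oppr0 if_same => /(congr1 u).
  rewrite raddf0 raddfD /= uA u0 ?addr0 ?(finset.set22 A B) 1?eq_sym //.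
  by move=> /eqP; rewrite eq_sym oner_eq0.
exists A, B, X; split=> //; apply: star_complex => //.
apply: star_chain => // t Dt ABt.
have tA : A \in t by apply: (fintype.subsetP ABt); rewrite !inE eqxx.
have tB : B \in t by apply: (fintype.subsetP ABt); rewrite !inE eqxx orbT.
have flip_u K (v : {scalar V}) : v (ev R (flip o K)) = 0 <-> v (ev R K) = 0.
  rewrite ev_flip; case: (o) => //; rewrite raddfN /=.
  by split=> [/eqP|->]; rewrite ?oppr0 // oppr_eq0 => /eqP.
pose F := [set K : {set I} | flip o K \in t]%SET.
have dual K : flip o K \in t -> exists v : {scalar V}, v (ev R K) != 0 /\
    forall L, L \in F -> L != K -> v (ev R L) = 0.
  move=> tK; have [v [vK v0]] := complex_indep sD Dt _ tK; exists v; split.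
    by apply/eqP => /flip_u; rewrite vK => /eqP; rewrite oner_eq0.
  move=> L; rewrite inE => tL LK; apply/flip_u/v0 => //.
  by rewrite (inj_eq (can_inj (flipK o))).
have [uA' [uA1 uA0]] := dual A' tA; have [uB' [uB1 uB0]] := dual B' tB.
have tmax K L : flip o K \in t -> flip o L \in t -> K \subset ~: L ->
    (#|K :|: L| <= #|A' :|: B'|)%N.
  move=> tK tL dKL; apply: (ABmax (K, L)) => /=; rewrite dKL andbT.
  by apply: complex_sub sD _ _ Dt _; rewrite finset.subUset !finset.sub1set tK.
have [|K L|||K|K|a [b [m [aA bB mX sepT]]]] :=
    @separating_points R n F A' B' uA' uB' _ _ _ _ dAB uA1 uA0 uB1 uB0 _ _.
- by move=> K; rewrite inE => /(complex_proper sD Dt); rewrite proper_flip.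
- rewrite !inE => tK tL; rewrite -(noncrossing_flip o).
  exact: (complex_noncrossing sD Dt tK tL).
- by rewrite inE.
- by rewrite inE.
- rewrite inE => tK /properP[sAK [i iK iA]]; apply/negP => dKB.
  have := tmax _ _ tK tB dKB; rewrite leqNgt => /negP; apply.
  apply: proper_card; apply/properP; split; first exact: finset.setSU.
  exists i; first by rewrite inE iK.
  have := fintype.subsetP dKB i iK; rewrite !inE => iB.
  by rewrite (negPf iA) (negPf iB).
- rewrite inE => tK /properP[sBK [i iK iB]]; apply/negP => dKA.
  have := tmax _ _ tK tA dKA; rewrite leqNgt => /negP; apply.
  rewrite finset.setUC.
  apply: proper_card; apply/properP; split; first exact: finset.setSU.
  exists i; first by rewrite inE iK.
  have := fintype.subsetP dKA i iK; rewrite !inE => iA.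
  by rewrite (negPf iA) (negPf iB).
exists a, b, m; split.
  have aB : a \notin B'.
    by have := fintype.subsetP dAB a aA; rewrite inE.
  have bA : b \notin A'.
    by apply: contraL bB => bA; have := fintype.subsetP dAB b bA; rewrite inE.
  move: mX; rewrite inE negb_or => /andP[mA mB].
  rewrite !mem_flip aA bB (negPf aB) (negPf bA) (negPf mA) (negPf mB).
  by case: (o).
move=> K tK KA KB; have [] := sepT (flip o K).
- by rewrite inE flipK.
- by rewrite -(inj_eq (can_inj (flipK o))) flipK.
- by rewrite -(inj_eq (can_inj (flipK o))) flipK.
- by rewrite !mem_flip => /addIb -> /addIb ->.
Qed.

End Step.

(** * Weyl chambers as cones over flags of subsets *)
Section Flags.
Variables (R : realType) (n : nat).
Local Notation V := (quo R n).
Local Notation I := 'I_n.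
Implicit Types (w : 'S_n) (S T A B U : {set I}) (s t f : {set {set I}}).
Implicit Types (D : {set {set {set I}}}) (c d : {set I} -> R).
Local Notation pcone := (@pcone R n).
Local Notation chamber := (@chamber R n).

Definition flag (w : 'S_n) : {set {set I}} :=
  [set T : {set I} | proper_set T &&
     [forall i : I, forall j : I, (i <= j)%N ==> (w i \in T) ==> (w j \in T)]]%SET.

Lemma flagP w T : reflect
  (proper_set T /\ forall i j : I, (i <= j)%N -> w i \in T -> w j \in T)
  (T \in flag w).
Proof.
rewrite inE; apply: (iffP andP) => -[pT H]; split=> //.
  by move=> i j ij wi; move/forallP/(_ i)/forallP/(_ j): H; rewrite ij wi.
apply/forallP => i; apply/forallP => j; apply/implyP => ij; apply/implyP.
exact: H.
Qed.

Lemma flag_chain w : is_chain (flag w).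
Proof.
move=> S T /flagP[_ Sw] /flagP[_ Tw].
have [//|/fintype.subsetPn[i iS iT]] := boolP (S \subset T).
apply/fintype.subsetP => j jT; rewrite -(permKV w j) in jT *.
rewrite -(permKV w i) in iS iT.
apply: Sw iS; case: (leqP ((w^-1)%g i) ((w^-1)%g j)) => // /ltnW ji.
by case/negP: iT; apply: Tw jT.
Qed.

Lemma sort_perm (x : I -> R) :
  exists w : 'S_n, forall i j : I, (i <= j)%N -> x (w i) <= x (w j).
Proof.
pose r := [rel i j : I | x i <= x j].
pose s := sort r (enum 'I_n).
have size_s : size s == n by rewrite size_sort size_enum_ord.
have r_total : total r by move=> i j; apply: le_total.
have r_trans : transitive r by move=> j i k; apply: le_trans.
have s_uniq : injective (tnth (Tuple size_s)).
  by apply/tuple_uniqP; rewrite sort_uniq enum_uniq.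
exists (perm s_uniq) => i j ij; rewrite !permE !(tnth_nth i) /=.
have r_refl : reflexive r by move=> k /=.
by apply: (sorted_leq_nth r_trans r_refl i (sort_sorted r_total _));
   rewrite // inE (eqP size_s).
Qed.

(** Order the points by the number of members of the chain that contain them. *)
Lemma chain_flag f : is_chain f -> proper_family f ->
  exists w, f \subset flag w.
Proof.
move=> fchain pf.
have [w wP] := sort_perm (fun i => #|[set U in f | i \in U]%SET|%:R).
exists w; apply/fintype.subsetP => T fT; apply/flagP; split; first exact: pf.
move=> i j ij iT; have := wP i j ij; rewrite ler_nat; apply: contraLR => jT.
rewrite -ltnNge; apply/proper_card/properP; split.
  apply/fintype.subsetP => U; rewrite !inE => /andP[fU jU]; rewrite fU /=.
  case/orP: (fchain U T fU fT) => /fintype.subsetP UT; last exact: UT.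
  by case/negP: jT; apply: UT.
by exists T; rewrite !inE fT ?iT // (negPf jT).
Qed.

Lemma chamber_convex w : convex_cone (chamber w).
Proof.
split=> [|_ _ [x xw <-] [y yw <-]|a _ a0 [x xw <-]].
- exists 0; first by move=> i j _; rewrite !mxE.
  by apply: coord_diff_inj => i j; rewrite coord_diff_proj raddf0 !mxE subrr.
- exists (x + y); last exact: projD.
  by move=> i j ij; rewrite !mxE lerD ?xw ?yw.
- exists (a *: x); last exact: projZ.
  by move=> i j ij; rewrite !mxE ler_wpM2l ?xw.
Qed.

(** A monotone vector is, modulo the all-ones vector, the sum of its successive
    increments times the indicators of the upper segments; this is a telescoping
    sum in each coordinate. *)
Lemma chamberE w : chamber w = pcone (flag w).
Proof.
rewrite eqEsubset; split; last first.
  apply: pcone_min (chamber_convex w) _ => T /flagP[_ wT].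
  exists (\row_i (i \in T)%:R) => // i j ij; rewrite !mxE ler_nat.
  by move: (wT i j ij); case: (w i \in T) => // ->.
move=> _ [x /= xw <-].
have [i0 _|n0] := pickP 'I_n; last first.
  rewrite (_ : proj x = 0); first by have [] := pcone_convex R (flag w).
  by apply: coord_diff_inj => i; have := n0 i.
have n_gt0 : (0 < n)%N := leq_ltn_trans (leq0n _) (ltn_ord i0).
(* o k is the index k for k < n, and i0 is a default value that never occurs. *)
pose o k : I := insubd i0 k.
have oE k : (k < n)%N -> o k = k :> nat by move=> kn; rewrite /o /insubd insubT.
pose y k := x ord0 (w (o k)).
pose T k := [set i : I | (k <= (w^-1)%g i)%N]%SET.
have xE : proj x = \sum_(0 <= k < n.-1) (y k.+1 - y k) *: ev R (T k.+1).
  have S i : \sum_(0 <= k < n.-1) (y k.+1 - y k) * (i \in T k.+1)%:R =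
             x ord0 i - y 0%N.
    have im : ((w^-1)%g i <= n.-1)%N by rewrite -ltnS prednK.
    rewrite (big_cat_nat _ im) //= [X in _ + X]big_nat.
    rewrite [X in _ + X]big1 ?addr0; last first.
      move=> k /andP[ik _]; rewrite inE (_ : (k < _)%N = false) ?mulr0 //.
      by rewrite ltnNge ik.
    rewrite big_nat (eq_bigr (fun k => y k.+1 - y k)); last first.
      by move=> k /andP[_ ki]; rewrite inE ki mulr1.
    rewrite -big_nat telescope_sumr // /y (_ : o _ = (w^-1)%g i) ?permKV //.
    by apply: val_inj; rewrite /= oE.
  apply: coord_diff_inj => i j; rewrite raddf_sum coord_diff_proj /=.
  under eq_bigr do rewrite linearZ /= coord_diff_ev mulrBr.
  by rewrite sumrB !S opprB addrA subrK.
rewrite xE big_nat; apply: convex_cone_sum (pcone_convex R _) _ => k /andP[_ km].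
have kn : (k.+1 < n)%N by rewrite -(prednK n_gt0) ltnS.
have [_ _ CZ] := pcone_convex R (flag w); apply: CZ.
  by rewrite subr_ge0; apply: xw; rewrite !oE // ltnW.
apply: pcone_ev; apply/flagP; split.
  apply/proper_setP; exists (w (o k.+1)), (w (o 0%N)).
  by rewrite !inE !permK !oE.
by move=> i j ij; rewrite !inE !permK => /leq_trans; apply.
Qed.

Lemma chamber_cover (x : V) : exists w, chamber w x.
Proof.
have [w wP] := sort_perm (fun i => repr x ord0 i).
by exists w, (repr x); rewrite ?projK.
Qed.

Lemma chamber_braid w : braid_fan R n (chamber w).
Proof.
exists w, \0 => //; rewrite eqEsubset; split=> x //=; last by case.
Qed.

End Flags.

(** * The complex of a complete smooth fan refined by the braid fan *)
Section FanToComplex.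
Variables (R : realType) (n : nat).
Local Notation V := (quo R n).
Local Notation I := 'I_n.
Implicit Types (T A B U : {set I}) (s t f M : {set {set I}}) (C F : set V).
Implicit Types (D : {set {set {set I}}}) (c d : {set I} -> R).
Local Notation pcone := (@pcone R n).

Variable (S : set (set V)).
Hypotheses (S_fan : is_fan S) (S_complete : complete S) (S_smooth : smooth S).
Hypothesis S_refined : refined_by S (braid_fan R n).

Lemma fan_cone C : S C -> convex_cone C.
Proof.
by case: S_fan => _ rp _ _ /rp[[A fA ->] _]; apply: cone_convex.
Qed.

Lemma refined_flag w : exists2 C, S C & pcone (flag w) `<=` C.
Proof. by rewrite -chamberE; apply: S_refined; apply: chamber_braid. Qed.

Lemma refined_chain f : is_chain f ->
  exists2 C, S C & forall T, T \in f -> C (ev R T).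
Proof.
move=> fchain; pose g := [set T in f | proper_set T]%SET.
have gchain : is_chain g.
  by move=> T U; rewrite !inE => /andP[fT _] /andP[fU _]; apply: fchain.
(* The improper members of f contribute the vector 0. *)
have [|w gw] := chain_flag R gchain; first by move=> T; rewrite inE => /andP[].
have [C SC wC] := refined_flag w; exists C => // T fT.
have [pT|] := boolP (proper_set T).
  by apply/wC/pcone_ev/(fintype.subsetP gw); rewrite inE fT.
have [C0 _ _] := fan_cone SC.
by rewrite negb_and !negbK => /orP[]/eqP ->; rewrite ?ev0 ?evT.
Qed.

(** The sum x + y lies in the face that C and C' have in common, and a face of C
    contains the summands of its points. *)
Lemma fan_summand C C' x y : S C -> S C' -> C x -> C y -> C' (x + y) -> C' x.
Proof.
move=> SC SC' Cx Cy Cxy; have [_ CD _] := fan_cone SC.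
have [_ _ _ /(_ C C' SC SC')[[u u0 E] _]] := S_fan.
suff : (C `&` C') x by case.
have : (C `&` C') (x + y) by split => //; apply: CD.
rewrite E => -[_]; rewrite raddfD /= => /eqP.
by rewrite paddr_eq0 ?u0 // => /andP[/eqP ux _].
Qed.

Definition cone_sets C := [set T : {set I} | proper_set T && `[< C (ev R T) >]]%SET.

Lemma cone_setsP C T :
  reflect (proper_set T /\ C (ev R T)) (T \in cone_sets C).
Proof.
by rewrite inE; apply: (iffP andP) => -[pT /asboolP CT].
Qed.

(** Each x is a positive combination of a flag lying in some cone of the fan, so
    the terms of this combination are in every cone that contains x. *)
Lemma fan_gen C : S C -> C = pcone (cone_sets C).
Proof.
move=> SC; have convC := fan_cone SC; rewrite eqEsubset; split; last first.
  by apply: pcone_min => // T /cone_setsP[].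
move=> x Cx; have [w] := chamber_cover x; rewrite chamberE => -[c c0 xE].
have [C' SC' wC'] := refined_flag w; have [_ _ CZ] := fan_cone SC'.
have convC' := fan_cone SC'.
have [P0 _ PZ] := pcone_convex R (cone_sets C).
rewrite xE; apply: convex_cone_sum (pcone_convex R _) _ => T wT.
have [->|cT] := eqVneq (c T) 0; first by rewrite scale0r.
apply: (PZ) => //; apply: pcone_ev; apply/cone_setsP; split.
  by case/flagP: wT.
have [_ _ CZ0] := convC; have cT0 : 0 < c T by rewrite lt_neqAle eq_sym cT c0.
suff CcT : C (c T *: ev R T).
  rewrite -[ev R T]scale1r -(mulVf cT) -scalerA; apply: CZ0 => //.
  by rewrite invr_ge0.
apply: (@fan_summand C' C _ (\sum_(U in flag w | U != T) c U *: ev R U)) => //.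
- by apply: CZ => //; apply/wC'/pcone_ev.
- apply: convex_cone_sum => // U /andP[wU _]; apply: CZ => //.
  exact/wC'/pcone_ev.
- by rewrite -bigD1 // -xE.
Qed.

(** A cone containing e_A with the fewest vectors e_T: its intersection with any
    other cone containing e_A is a cone of the fan with no fewer vectors. *)
Lemma smallest_cone A : proper_set A ->
  exists K : set V,
    [/\ S K, K (ev R A) & forall C, S C -> C (ev R A) -> K `<=` C].
Proof.
move=> pA; pose P k := `[< exists C, [/\ S C, C (ev R A) & #|cone_sets C| = k] >].
have exP : exists k, P k.
  have [C SC CA] : (\bigcup_(C in S) C) (ev R A) by rewrite S_complete.
  by exists #|cone_sets C|; apply/asboolP; exists C.
have [_ /asboolP[K [SK KA <-]] Kmin] := ex_minnP exP.
exists K; split=> // C SC CA.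
have [_ _ faceS interS] := S_fan.
have SKC : S (K `&` C) by apply: (faceS _ _ SK); case: (interS K C SK SC).
suff -> : K = K `&` C by move=> x [].
rewrite [LHS](fan_gen SK) [RHS](fan_gen SKC); congr pcone; apply/eqP.
rewrite eq_sym finset.eqEcard; apply/andP; split.
  by apply/fintype.subsetP => U /cone_setsP[pU [KU _]]; apply/cone_setsP.
by apply: Kmin; apply/asboolP; exists (K `&` C).
Qed.

(** A functional exposing the ray of a generator A that cannot be omitted comes
    from the fan axioms, once the smallest cone containing e_A is known to be
    this ray. If it contained another e_B, consider
      e_A = e_B + (e_(A - B) + e_(complement of B - A)).
    The sets A - B, A and the complement of B - A form a chain, hence lie in one
    cone, which then also contains e_B; so all summands lie in C. Expanding them
    in the generators makes A superfluous, unless e_B is a multiple of e_A. *)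
Lemma minimal_gen_ray C M A : S C -> C = pcone M -> M \subset cone_sets C ->
  A \in M -> ~ (C = pcone (M :\ A)%SET) -> ray C (pcone [set A]%SET).
Proof.
move=> SC CM sM MA nMA.
have /cone_setsP[pA CA] := fintype.subsetP sM A MA.
have [T [ST TA Tmin]] := smallest_cone pA.
have TE : cone_sets T = [set A]%SET.
  apply/setP => B; rewrite [RHS]inE.
  apply/idP/eqP => [/cone_setsP[pB TB]|->]; last first.
    exact/cone_setsP.
  pose f := [set A :\: B; A; ~: (B :\: A)]%SET.
  have [C' SC' fC'] : exists2 C', S C' & forall U, U \in f -> C' (ev R U).
    apply: refined_chain => U U'; rewrite !inE -!orbA.
    have s1 : A :\: B \subset A by apply: finset.subsetDl.
    have s2 : A \subset ~: (B :\: A).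
      by apply/fintype.subsetP => i iA; rewrite !inE iA.
    have s3 := fintype.subset_trans s1 s2.
    by case/or3P=> /eqP -> /or3P[] /eqP ->;
       rewrite ?fintype.subxx ?s1 ?s2 ?s3 ?orbT.
  have C'B : C' (ev R B).
    by apply: (Tmin C') => //; apply: fC'; rewrite !inE eqxx orbT.
  pose y := ev R (A :\: B) + ev R (~: (B :\: A)).
  have AE : ev R A = ev R B + y.
    apply: coord_diff_inj => i j; rewrite !raddfD /= !coord_diff_ev !inE.
    by case: (i \in A); case: (i \in B); case: (j \in A); case: (j \in B);
       rewrite /=; lra.
  have [_ C'D _] := fan_cone SC'.
  have C'y : C' y by apply: C'D; apply: fC'; rewrite !inE eqxx ?orbT.
  have CB : C (ev R B) by apply: (fan_summand SC' SC C'B C'y); rewrite -AE.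
  have Cy : C y by apply: (fan_summand SC' SC C'y C'B); rewrite addrC -AE.
  have := CB; rewrite CM => -[d d0 BE].
  have := Cy; rewrite CM => -[h h0 yE].
  pose z := \sum_(U in M | U != A) d U *: ev R U.
  pose z' := \sum_(U in M | U != A) h U *: ev R U.
  have [C0 CD CZ] := fan_cone SC.
  have Mz e : (forall U, 0 <= e U) ->
      pcone (M :\ A)%SET (\sum_(U in M | U != A) e U *: ev R U).
    move=> e0; have [_ _ PZ] := pcone_convex R (M :\ A)%SET.
    apply: convex_cone_sum (pcone_convex R _) _ => U /andP[MU UA].
    by apply: (PZ) => //; apply: pcone_ev; rewrite !inE UA.
  have sMA : pcone (M :\ A)%SET `<=` C.
    by rewrite CM; apply: pcone_sub; apply: finset.subsetDl.
  (* Compare the coefficients of e_A in e_A = e_B + y. *)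
  have AE' : (1 - (d A + h A)) *: ev R A = z + z'.
    rewrite scalerBl scale1r {1}AE BE yE (bigD1 A) //= (bigD1 A MA) /= -/z -/z'.
    by rewrite scalerDl addrACA [_ + (z + z')]addrC addrK.
  have [dh|dh] := ltP (d A + h A) 1.
    case: nMA; rewrite eqEsubset; split=> //.
    rewrite [X in X `<=` _]CM; apply: pcone_min (pcone_convex R _) _ => U MU.
    have [->|UA] := eqVneq U A; last by apply: pcone_ev; rewrite !inE UA.
    have dh0 : 0 < 1 - (d A + h A) by rewrite subr_gt0.
    rewrite -[ev R A]scale1r -(mulVf (lt0r_neq0 dh0)) -scalerA AE'.
    have [_ PD PZ] := pcone_convex R (M :\ A)%SET.
    apply: (PZ); first by rewrite invr_ge0 ltW.
    by apply: (PD); apply: Mz.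
  (* Now a nonnegative multiple of e_A plus z + z' is 0, so that - z is in C. *)
  have z0 : z = 0.
    have [_ sc _ _] := S_fan; have [_ scC] := sc C SC.
    apply: scC; first exact/sMA/Mz.
    rewrite (_ : - z = (d A + h A - 1) *: ev R A + z').
      by apply: CD; [apply: CZ; rewrite ?subr_ge0|exact/sMA/Mz].
    rewrite -[d A + h A - 1]opprK opprB scaleNr AE' opprD -addrA.
    by rewrite addNr addr0.
  have BdA : ev R B = d A *: ev R A by rewrite BE (bigD1 A) //= -/z z0 addr0.
  have dA : 0 < d A.
    rewrite lt_neqAle d0 andbT; apply: contraTneq (ev_neq0 R pB) => dA.
    by rewrite BdA -dA scale0r eqxx.
  by apply: (@evZ_inj R n 1 (d A)) => //; rewrite scale1r.
split; last by exists (ev R A); [exact: ev_neq0|exact: pcone1].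
have [_ _ _ /(_ C T SC ST)[+ _]] := S_fan.
by rewrite (setIidr (Tmin C SC CA)) -TE -fan_gen.
Qed.

(** A minimal generating family of C consists of generators of rays of C, which
    by smoothness belong to a lattice basis. *)
Lemma fan_simplicial C : S C ->
  exists M, [/\ proper_family M, unimodular M & C = pcone M].
Proof.
move=> SC.
pose P := [pred M : {set {set I}} |
  (M \subset cone_sets C) && `[< C = pcone M >]].
have P0 : P (cone_sets C).
  by rewrite /P /= fintype.subxx; apply/asboolP/fan_gen.
have [M /andP[sM /asboolP CM] Mmin] :=
  arg_minnP (fun M : {set {set I}} => #|M|) P0.
have pM : proper_family M.
  by move=> T /(fintype.subsetP sM)/cone_setsP[].
exists M; split=> //; have [b Zb Cb] := S_smooth SC; exists b => // A MA.
apply: Cb; split; first exact/ev_primitive/pM.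
exists (pcone [set A]%SET); last by rewrite latt_ev; apply: pcone_ev; rewrite inE.
apply: (minimal_gen_ray SC CM sM MA) => CMA.
have : P (M :\ A)%SET.
  rewrite /P /= (fintype.subset_trans (finset.subsetDl _ _) sM).
  exact/asboolP.
by move/Mmin; rewrite [X in (X <= _)%N](cardsD1 A) MA ltnn.
Qed.

Definition fan_complex : {set {set {set I}}} :=
  [set s : {set {set I}} |
    `[< [/\ proper_family s, unimodular s & S (pcone s)] >]]%SET.

Lemma fan_complexP s : reflect
  [/\ proper_family s, unimodular s & S (pcone s)] (s \in fan_complex).
Proof. by rewrite inE; apply: asboolP. Qed.

Lemma fan_complexE : fan_of fan_complex = S.
Proof.
rewrite eqEsubset; split=> C; first by move=> [s /fan_complexP[_ _ Ss] <-].
move=> SC; have [M [pM uM CM]] := fan_simplicial SC.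
by exists M => //=; apply/fan_complexP; rewrite -CM.
Qed.

Lemma fan_complex_sub s t : s \in fan_complex -> t \subset s -> t \in fan_complex.
Proof.
move=> /fan_complexP[ps us Ss] ts; apply/fan_complexP; split.
- by move=> T /(fintype.subsetP ts)/ps.
- exact: unimodular_sub us.
- have [_ _ faceS _] := S_fan; apply: faceS Ss _.
  by apply: pcone_faceP => //; apply: unimodular_indep.
Qed.

Lemma fan_smooth_complex : smooth_complex R fan_complex.
Proof.
have [_ _ faceS interS] := S_fan.
split.
- exact: fan_complex_sub.
- by move=> s /fan_complexP[].
- by move=> s /fan_complexP[].
- move=> x; have [C SC Cx] : (\bigcup_(C in S) C) x by rewrite S_complete.
  have [M [pM uM CM]] := fan_simplicial SC.
  move: Cx; rewrite CM => /pconeP[c [c0 cM xE]]; exists c; split=> //.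
  by apply: fan_complex_sub cM; apply/fan_complexP; rewrite -CM.
- move=> x c d [c0 Dc xc] [d0 Dd xd].
  have [ps us Ss] := fan_complexP _ Dc; have [pt ut St] := fan_complexP _ Dd.
  have is_ : indep R (supp c) by apply: unimodular_indep.
  have it : indep R (supp d) by apply: unimodular_indep.
  have sx : pcone (supp c) x by apply/pconeP; exists c.
  have tx : pcone (supp d) x by apply/pconeP; exists d.
  have supp_face e s' : indep R (supp e) -> s' \subset supp e ->
      pcone s' x -> x = \sum_T e T *: ev R T -> s' = supp e.
    move=> ie ss' s'x xe; apply/eqP; rewrite finset.eqEsubset ss' /=.
    rewrite xe -(sum_supp (fintype.subxx _)) in s'x.
    apply/fintype.subsetP => T eT; apply/negPn/negP => s'T.
    by move: (eT); rewrite inE (pcone_coef_supp ie ss' s'x eT s'T) eqxx.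
  have [/pcone_face_sub[s' ss' Es'] /pcone_face_sub[t' tt' Et']] :=
    interS _ _ Ss St.
  have stx : (pcone (supp c) `&` pcone (supp d)) x by [].
  have s'E : s' = supp c by apply: supp_face; rewrite -?Es'.
  have t'E : t' = supp d by apply: supp_face; rewrite -?Et'.
  have st : supp c = supp d.
    by apply: (@pcone_inj R n) => //; rewrite -s'E -t'E -Es'.
  move=> T; have [sT|sT] := boolP (T \in supp c).
    apply: (indep_coef is_ _ sT); rewrite sum_supp // [in RHS]st sum_supp //.
    by rewrite -xc.
  have := sT; rewrite st; move: sT; rewrite !inE !negbK.
  by move=> /eqP -> /eqP ->.
- move=> f /refined_chain[C SC Cf]; have [M [pM uM CM]] := fan_simplicial SC.
  by exists M => [|T /Cf]; [apply/fan_complexP|]; rewrite -CM.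
Qed.

End FanToComplex.

(** * Reaching the braid fan *)
Section Main.
Variables (R : realType) (n : nat).
Local Notation V := (quo R n).
Local Notation I := 'I_n.
Implicit Types (T A B : {set I}) (s t f M : {set {set I}}).
Implicit Types (D : {set {set {set I}}}) (S : set (set V)).
Local Notation pcone := (@pcone R n).
Local Notation fan_of := (@fan_of R n).

(** If e_T is a combination of a chain with a positive coefficient at U, then
    e_T is larger at the points of U than at the points outside U, so T = U. As
    each full flag lies in the cone over some chain of D, it is therefore
    contained in that chain, and D consists exactly of the chains. *)
Lemma chain_complex_braid D : smooth_complex R D ->
  (forall s, s \in D -> is_chain s) -> fan_of D = braid_fan R n.
Proof.
move=> sD Dchain.
have flagD w : flag w \in D.
  have [s Ds ws] := complex_chain sD (@flag_chain n w).
  apply: (complex_sub sD Ds); apply/fintype.subsetP => T wT.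
  have pT : proper_set T by case/flagP: (wT).
  have [c c0 TE] := ws T wT.
  have [U sU cU] : exists2 U, U \in s & c U != 0.
    apply: contrapT => nU; move: (ev_neq0 R pT); rewrite TE big1 ?eqxx // => U sU.
    have [->|cU] := eqVneq (c U) 0; first by rewrite scale0r.
    by case: nU; exists U.
  suff -> : T = U by [].
  (* For i in U and j outside U no member of the chain s contains j but not i. *)
  have lt_TU i j : i \in U -> j \notin U -> (i \in T) && (j \notin T).
    move=> iU jU; have := coord_diff_ev R i j T.
    rewrite TE raddf_sum (bigD1 U) //= linearZ /= coord_diff_ev iU (negPf jU).
    rewrite subr0 mulr1; set r := \sum_(_ in _ | _) _ => E.
    have r0 : 0 <= r.
      apply: sumr_ge0 => W /andP[sW _]; rewrite linearZ /= coord_diff_ev.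
      apply: mulr_ge0 => //; rewrite subr_ge0 ler_nat.
      case/orP: (Dchain s Ds U W sU sW) => /fintype.subsetP sub.
        by rewrite (sub i iU); case: (j \in W).
      by case: (boolP (j \in W)) => // /sub; rewrite (negPf jU).
    have : 0 < (i \in T)%:R - (j \in T)%:R :> R.
      by rewrite -E ltr_pwDl // lt_neqAle eq_sym cU c0.
    by case: (i \in T); case: (j \in T) => /=; lra.
  have /proper_setP[i0 [j0 [iU jU]]] := complex_proper sD Ds _ sU.
  apply/setP => k; have [kU|kU] := boolP (k \in U).
    by have /andP[->] := lt_TU k j0 kU jU.
  by have /andP[_ /negPf ->] := lt_TU i0 k iU kU.
rewrite eqEsubset; split=> F.
  move=> [s /= Ds <-]; have [w sw] :=
    chain_flag R (Dchain s Ds) (complex_proper sD Ds).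
  by exists w; rewrite chamberE; apply: pcone_faceP sw;
     exact: (complex_indep sD (flagD w)).
move=> [w]; rewrite chamberE => /pcone_face_sub[t tw ->]; exists t => //=.
exact: (complex_sub sD (flagD w)).
Qed.

Lemma obtained_refl S : is_fan S -> obtained_by_stars S S.
Proof. by move=> fS; exists 0%N, (fun=> S). Qed.

Lemma obtained_step S S' S'' : is_fan S -> star_step S S' ->
  obtained_by_stars S' S'' -> obtained_by_stars S S''.
Proof.
move=> fS step [l [D [D0 Dl fans steps]]].
exists l.+1, (fun i => if i is j.+1 then D j else S); split=> //.
  by move=> [|i] //; apply: fans.
by move=> [|i] // il; [rewrite D0|apply: steps].
Qed.

(** Induction on the number of subsets that are not vertices of D: the vertex X
    is new in the star subdivision, and no vertex disappears. *)
Lemma complex_obtained D : smooth_complex R D ->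
  obtained_by_stars (fan_of D) (braid_fan R n).
Proof.
pose vertices D := [set T : {set I} | [set T]%SET \in D]%SET.
have [k] := ubnP (#|{set I}| - #|vertices D|)%N; elim: k D => // k IH D kD sD.
have [Dchain|] := pselect (forall s, s \in D -> is_chain s).
  rewrite -(chain_complex_braid sD Dchain).
  exact/obtained_refl/fan_of_is_fan.
move=> /existsNP[s /not_implyP[Ds nchain]].
have [A [B [X [AB DAB pX XE sD']]]] : exists A B X, [/\ A != B,
    [set A; B]%SET \in D, proper_set X, ev int X = ev int A + ev int B
    & smooth_complex R (star D A B X)].
  apply: contrapT => nex; apply: nchain => S T sS sT.
  apply: contrapT => /negP; rewrite negb_or => /andP[nST nTS].
  exact/nex/(exists_star sD Ds sS sT nST nTS).
apply: obtained_step (fan_of_is_fan sD) _ (IH _ _ sD').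
  split; first exact: fan_of_smooth.
  exists (pcone [set A; B]%SET); split; first by exists [set A; B]%SET.
    move=> E; have : pcone [set A; B]%SET (ev R A).
      by apply: pcone_ev; rewrite !inE eqxx.
    rewrite E => /= A0; have := ev_neq0 R (proper_left sD DAB).
    by rewrite A0 eqxx.
  by rewrite (star_fan sD AB DAB pX XE).
have lt_vert : (#|vertices D| < #|vertices (star D A B X)|)%N.
  have nAB T : ~~ ([set A; B]%SET \subset [set T]%SET).
    apply: contra AB => /fintype.subsetP sub.
    have := sub A (finset.set21 A B); have := sub B (finset.set22 A B).
    by rewrite !inE => /eqP -> /eqP ->.
  apply/proper_card/properP; split.
    by apply/fintype.subsetP => T; rewrite !inE nAB => ->.
  exists X; rewrite inE; last first.
    by apply/negP => /(center_notin sD AB DAB XE); rewrite inE eqxx.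
  rewrite inE nAB; apply/orP; right; apply/exists_inP.
  by exists [set A; B]%SET; rewrite // fintype.subxx /= finset.subsetUl.
rewrite ltnS in kD; apply: leq_trans kD; apply: ltn_sub2l => //.
exact: leq_trans lt_vert (max_card _).
Qed.

End Main.

Theorem corollary3p3 (R : realType) (n : nat) (S1 S2 : set (set (quo R n)))
    (fan1 : is_fan S1) (complete1 : complete S1) (smooth1 : smooth S1)
    (refined1 : refined_by S1 (braid_fan R n))
    (fan2 : is_fan S2) (complete2 : complete S2) (smooth2 : smooth S2)
    (refined2 : refined_by S2 (braid_fan R n)) :
  (exists S3 : set (set (quo R n)),
     [/\ is_fan S3, obtained_by_stars S1 S3 & obtained_by_stars S2 S3]) /\
  (obtained_by_stars S1 (braid_fan R n) /\
   obtained_by_stars S2 (braid_fan R n)).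
Proof.
have to_braid S : is_fan S -> complete S -> smooth S ->
    refined_by S (braid_fan R n) -> obtained_by_stars S (braid_fan R n).
  move=> fanS completeS smoothS refinedS.
  rewrite -[X in obtained_by_stars X](fan_complexE fanS completeS smoothS refinedS).
  exact/complex_obtained/fan_smooth_complex.
have to1 := to_braid S1 fan1 complete1 smooth1 refined1.
have to2 := to_braid S2 fan2 complete2 smooth2 refined2.
split=> //; exists (braid_fan R n); split=> //.
by case: to1 => l [D [_ <- fans _]]; apply: fans.
Qed.
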